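(* Let $H$ be a graded, connected, free and cofree Hopf algebra over $K$, and put $r_n=\dim(H_n)$ for $n\ge1$. Then $H$ is isomorphic, as a graded Hopf algebra, to a noncommutative Connes–Kreimer Hopf algebra $\mathcal H_{NCK}^{\mathcal D}$ for some graded set $\mathcal D$ if, and only if, $D_n(r_1,\dots,r_n)\ge0$ for all $n\ge1$.
   Context: $K$ is a field of characteristic $0$. A graded connected Hopf algebra is a Hopf algebra $H=\bigoplus_{n\ge0}H_n$ over $K$ with homogeneous structure maps, $H_0=K$ and every $H_n$ finite-dimensional. $H$ is free if there is a graded subspace $V$ with $T(V)\to H$ an algebra isomorphism; cofree if it is isomorphic as a graded coalgebra to $coT(W)$ ($T(W)$ with deconcatenation coproduct) for some graded $W$ with $W_0=0$. The polynomials $D_n\in\mathbb Q[R_1,\dots,R_n]$ are defined by $\sum_{n\ge1}D_n(R_1,\dots,R_n)h^n=\frac{R(h)-1}{R(h)^2}$ where $R(h)=1+\sum_{k\ge1}R_kh^k$ (equivalently $\sum_{n\ge1}(-1)^{n+1}n(\sum_{k\ge1}R_kh^k)^n$); e.g. $D_1=R_1$, $D_2=R_2-2R_1^2$. A graded set is a set $\mathcal D=\bigsqcup_{n\ge1}\mathcal D_n$ with each $\mathcal D_n$ finite. The noncommutative Connes–Kreimer Hopf algebra $\mathcal H_{NCK}^{\mathcal D}$ has as basis the planar rooted forests (finite words of planar rooted trees, including the empty forest $1$) whose vertices are decorated by elements of $\mathcal D$; the product is concatenation of forests, the degree of a forest is the sum of the degrees of its decorations, and the coproduct is $\Delta(F)=\sum_c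 P^c(F)\otimes R^c(F)$, summed over admissible cuts $c$ of $F$ (sets of edges such that every path from a root to a leaf contains at most one edge of $c$, including the empty cut and the total cut), where $R^c(F)$ is the planar forest formed by the components containing the roots and $P^c(F)$ is the planar forest of the cut-off components. *)

(* Defs.v *)
From HB Require Import structures.
From mathcomp Require Import all_boot all_order all_algebra.
From mathcomp Require Import finmap.
From mathcomp.multinomials Require Import monalg.
Set Implicit Arguments.
Unset Strict Implicit.
Unset Printing Implicit Defensive.
Import GRing.Theory.
Local Open Scope ring_scope.

(* Linear algebra on free modules {malg K[B]} (K-vector space with      *)
(* basis B; the basis vector of b is << b >>, coefficient of b is x@_b). *)

Section Lin.
Variable K : fieldType.

Definition lin (B : choiceType) (V : lmodType K) (f : B -> V)
    (x : {malg K[B]}) : V :=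
  \sum_(b <- msupp x) x@_b *: f b.

Definition linK (B : choiceType) (f : B -> K) (x : {malg K[B]}) : K :=
  \sum_(b <- msupp x) x@_b * f b.

Definition bilin (B1 B2 : choiceType) (V : lmodType K) (f : B1 -> B2 -> V)
    (x : {malg K[B1]}) (y : {malg K[B2]}) : V :=
  \sum_(b <- msupp x) \sum_(c <- msupp y) (x@_b * y@_c) *: f b c.

(* tensor product x (x) y, where {malg K[B1 * B2]} is the tensor product
   of {malg K[B1]} and {malg K[B2]} (basis: pairs of basis vectors) *)
Definition tens (B1 B2 : choiceType) (x : {malg K[B1]}) (y : {malg K[B2]})
    : {malg K[(B1 * B2)%type]} :=
  bilin (fun a b => << (a, b) >>) x y.

End Lin.

(* A graded Hopf algebra H over K given by a homogeneous basis B with     *)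
(* degree function deg, multiplication mu (on basis vectors), unit u,     *)
(* coproduct delta (on basis vectors, valued in H (x) H), counit eps.     *)

Section GradedHopf.
Variables (K : fieldType) (B : choiceType) (deg : B -> nat).
Variables (mu : B -> B -> {malg K[B]}) (u : {malg K[B]}).
Variables (delta : B -> {malg K[(B * B)%type]}) (eps : B -> K).

Definition mulH (x y : {malg K[B]}) : {malg K[B]} := bilin mu x y.

Definition finite_graded : Prop :=
  forall n : nat, exists s : seq B, forall b, deg b = n -> b \in s.

(* connected: H_0 is one-dimensional (H_0 = K 1, see unit axioms) *)
Definition connected_deg : Prop :=
  exists b0 : B, forall b, deg b = 0%N <-> b = b0.

Definition homogeneous_structure : Prop :=
  [/\ (forall a b c, c \in msupp (mu a b) -> deg c = (deg a + deg b)%N),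
      (forall c, c \in msupp u -> deg c = 0%N),
      (forall b (p : B * B), p \in msupp (delta b) -> (deg p.1 + deg p.2)%N = deg b)
    & (forall b, eps b != 0 -> deg b = 0%N)].

Definition is_algebra : Prop :=
  (forall a b c, mulH (mu a b) << c >> = mulH << a >> (mu b c)) /\
  (forall b, mulH u << b >> = << b >> /\ mulH << b >> u = << b >>).

Definition is_coalgebra : Prop :=
  (forall b,
     lin (fun p : B * B => lin (fun q : B * B => << (q, p.2) >>) (delta p.1)) (delta b)
   = lin (fun p : B * B => lin (fun q : B * B => << ((p.1, q.1), q.2) >>) (delta p.2)) (delta b))
  /\
  (forall b, lin (fun p : B * B => eps p.1 *: << p.2 >>) (delta b) = << b >> /\
             lin (fun p : B * B => eps p.2 *: << p.1 >>) (delta b) = << b >>).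

Definition is_bialgebra_compat : Prop :=
  [/\ (forall a b, lin delta (mu a b)
                  = bilin (fun p q : B * B => tens (mu p.1 q.1) (mu p.2 q.2))
                          (delta a) (delta b)),
      lin delta u = tens u u,
      (forall a b, linK eps (mu a b) = eps a * eps b)
    & linK eps u = 1].

Definition has_antipode : Prop :=
  exists S : B -> {malg K[B]},
    forall b, lin (fun p : B * B => mulH (S p.1) << p.2 >>) (delta b) = eps b *: u /\
              lin (fun p : B * B => mulH << p.1 >> (S p.2)) (delta b) = eps b *: u.

Definition is_gc_hopf : Prop :=
  finite_graded /\ connected_deg /\ homogeneous_structure /\
  is_algebra /\ is_coalgebra /\ is_bialgebra_compat /\ has_antipode.

(* free: T(V) -> H (canonical algebra map) is an isomorphism, for a graded
   subspace V with homogeneous basis (v i)_{i in I}; T(V) is the free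
   module on words in I. *)
Definition word_val (I : choiceType) (v : I -> {malg K[B]}) (w : seq I)
    : {malg K[B]} := foldr (fun i acc => mulH (v i) acc) u w.

Definition is_free_alg : Prop :=
  exists (I : choiceType) (v : I -> {malg K[B]}),
    (forall i, exists n, forall c, c \in msupp (v i) -> deg c = n) /\
    bijective (lin (word_val v)).

Definition dim_deg (n m : nat) : Prop :=
  exists s : seq B, [/\ uniq s, size s = m & forall b, deg b = n <-> b \in s].

End GradedHopf.

Section Morphisms.
Variables (K : fieldType) (B1 B2 : choiceType).
Variables (deg1 : B1 -> nat) (deg2 : B2 -> nat).

Definition graded_map (f : B1 -> {malg K[B2]}) : Prop :=
  forall b c, c \in msupp (f b) -> deg2 c = deg1 b.

Definition coalg_iso (delta1 : B1 -> {malg K[(B1 * B1)%type]}) (eps1 : B1 -> K)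
    (delta2 : B2 -> {malg K[(B2 * B2)%type]}) (eps2 : B2 -> K)
    (f : B1 -> {malg K[B2]}) : Prop :=
  [/\ graded_map f, bijective (lin f),
      (forall b, lin delta2 (f b) = lin (fun p : B1 * B1 => tens (f p.1) (f p.2)) (delta1 b))
    & (forall b, linK eps2 (f b) = eps1 b)].

Definition hopf_iso
    (mu1 : B1 -> B1 -> {malg K[B1]}) (u1 : {malg K[B1]})
    (delta1 : B1 -> {malg K[(B1 * B1)%type]}) (eps1 : B1 -> K)
    (mu2 : B2 -> B2 -> {malg K[B2]}) (u2 : {malg K[B2]})
    (delta2 : B2 -> {malg K[(B2 * B2)%type]}) (eps2 : B2 -> K)
    (f : B1 -> {malg K[B2]}) : Prop :=
  [/\ coalg_iso delta1 eps1 delta2 eps2 f,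
      (forall a b, lin f (mu1 a b) = mulH mu2 (f a) (f b))
    & lin f u1 = u2].

End Morphisms.

(* Cofree: isomorphic as graded coalgebra to coT(W), W graded, W_0 = 0.   *)
(* W has homogeneous basis J with degrees wdeg; coT(W) has basis words.   *)

Section Cofree.
Variable K : fieldType.

Definition word_deg (J : Type) (wdeg : J -> nat) (w : seq J) : nat :=
  sumn (map wdeg w).

Definition deconc (J : choiceType) (w : seq J) : {malg K[(seq J * seq J)%type]} :=
  \sum_(i < (size w).+1) << (take i w, drop i w) >>.

Definition eps_word (J : choiceType) (w : seq J) : K := (w == [::])%:R.

Definition is_cofree_coalg (B : choiceType) (deg : B -> nat)
    (delta : B -> {malg K[(B * B)%type]}) (eps : B -> K) : Prop :=
  exists (J : choiceType) (wdeg : J -> nat),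
    (forall j, 0 < wdeg j)%N /\
    exists f : B -> {malg K[seq J]},
      coalg_iso deg (word_deg wdeg) delta eps (@deconc J) (@eps_word J) f.

End Cofree.

Inductive ptree (D : Type) := PNode of D & seq (ptree D).
Arguments PNode {D}.

Section PTreeChoice.
Variable D : choiceType.

Fixpoint ptree_enc (t : ptree D) : GenTree.tree D :=
  let: PNode d ts := t in GenTree.Node 0 (GenTree.Leaf d :: map ptree_enc ts).

Fixpoint ptree_dec (g : GenTree.tree D) : option (ptree D) :=
  match g with
  | GenTree.Node 0 (GenTree.Leaf d :: gs) => Some (PNode d (pmap ptree_dec gs))
  | _ => None
  end.

Lemma ptree_encK : pcancel ptree_enc ptree_dec.
Proof.
rewrite /pcancel; fix IH 1 => -[d ts] /=; congr (Some (PNode d _)).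
elim: ts => //= t ts IHts; by rewrite IH /= IHts.
Qed.

HB.instance Definition _ := Equality.copy (ptree D) (pcan_type ptree_encK).
HB.instance Definition _ := Choice.copy (ptree D) (pcan_type ptree_encK).
End PTreeChoice.

Definition forest (D : Type) := seq (ptree D).

Section NCK.
Variables (K : fieldType) (D : choiceType) (dg : D -> nat).

Definition graded_set : Prop :=
  (forall d, 0 < dg d)%N /\
  (forall n, exists s : seq D, forall d, dg d = n -> d \in s).

Fixpoint tdeg (t : ptree D) : nat :=
  let: PNode d ts := t in (dg d + sumn (map tdeg ts))%N.

Definition nck_deg (F : forest D) : nat := sumn (map tdeg F).

(* admissible cuts of a tree t: pairs (P^c, R^c) (pruned forest, trunk
   forest); either the edge above the root is cut (total cut: (t, 1)), or
   the root is kept and each child subtree is cut recursively. *)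
Fixpoint cutsT (t : ptree D) : seq (forest D * forest D) :=
  let: PNode d ts := t in
  let fix cutsF (ts : seq (ptree D)) : seq (forest D * forest D) :=
      match ts with
      | [::] => [:: ([::], [::])]
      | t' :: ts' => [seq (p.1 ++ q.1, p.2 ++ q.2) | p <- cutsT t', q <- cutsF ts']
      end in
  ([:: t], [::]) :: [seq (p.1, [:: PNode d p.2]) | p <- cutsF ts].

Fixpoint cutsF (F : forest D) : seq (forest D * forest D) :=
  match F with
  | [::] => [:: ([::], [::])]
  | t :: F' => [seq (p.1 ++ q.1, p.2 ++ q.2) | p <- cutsT t, q <- cutsF F']
  end.

Definition nck_mu (F G : forest D) : {malg K[forest D]} := << F ++ G >>.
Definition nck_unit : {malg K[forest D]} := << [::] >>.
Definition nck_delta (F : forest D) : {malg K[(forest D * forest D)%type]} :=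
  \sum_(p <- cutsF F) << p >>.
Definition nck_eps (F : forest D) : K := (F == [::])%:R.

End NCK.

(* The polynomials D_n, evaluated at integers r_1, ..., r_n:              *)
(* coefficient of h^n in sum_{k>=1} (-1)^(k+1) k (sum_{j>=1} r_j h^j)^k.  *)
(* (Terms k > n and j > n do not contribute to the coefficient of h^n.)   *)

Definition Dpoly_int (r : nat -> int) (n : nat) : int :=
  let P : {poly int} := \sum_(1 <= j < n.+1) r j *: 'X^j in
  (\sum_(1 <= k < n.+1) (((-1) ^+ k.+1 * k%:R) : int) *: P ^+ k)`_n.

(* Main.v *)
Require Import Defs.
From HB Require Import structures.
From mathcomp Require Import all_boot all_order all_algebra.
From mathcomp Require Import finmap.
From mathcomp.multinomials Require Import monalg.
From mathcomp Require Import zify ring.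
From Stdlib Require Import Classical_Prop ClassicalEpsilon.
Set Implicit Arguments.
Unset Strict Implicit.
Unset Printing Implicit Defensive.
Import GRing.Theory.
Local Open Scope ring_scope.

(** Transport the Hopf algebra [H] to the words of a cofree coalgebra [coT(W)],
    where the coefficient of [a (x) b] in the coproduct of [x] is the
    coefficient of [a ++ b] in [x].  Freeness and cofreeness make the numbers of
    generators and of letters of degree [n] determined by the dimensions [r],
    hence both equal to the number of planar trees of degree [n] once the graded
    set is chosen with [D_n(r)] elements in degree [n].

    A Hopf isomorphism from the planar forests to [H] is then built degree by
    degree.  In degree [n] its matrix has four blocks: rows are trees or
    decomposable forests, columns are letters or longer words.  Everything is
    forced except the square block (trees, letters), which is arbitrary because
    letters are primitive.  The rows of decomposable forests are free because [H]
    is free.  The columns of longer words are free because a primitive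
    combination of forests of degree [n] is determined by its coefficients on
    the forests whose first tree is a single vertex, and there are as many of
    those as trees.  Such a matrix can be completed to an invertible one. *)

(** * Linear algebra on free modules *)

(** The numbers [D_n] come from two decompositions. Let F, T and E be the generating series of
    forests, trees and decorations. A forest is a word of trees, so F = 1 + T F; a tree is a root
    above a forest, so T = E F. Hence E = (F - 1) / F^2, the series defining [D_n]. This gives the
    necessity of D_n >= 0 and, conversely, the size of the graded set. The obstacle to sufficiency
    is that freeness controls products and cofreeness controls coproducts, in unrelated bases. Once
    the coproduct is respected, only the letter coefficients of the new generators remain free, and
    one choice of them must make the whole matrix invertible. In a primitive combination, a forest
    with first tree B_d(G), of root d and children G, is detected by the cut just below that root.
    It yields G (x) (d F), and any other forest with this cut has a smaller first tree. The
    multiplicity of the cut is a positive integer, nonzero in characteristic 0. *)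

Section LinearExtension.
Variable K : fieldType.

Lemma lin_fset (B : choiceType) (V : lmodType K) (f : B -> V) (x : {malg K[B]})
    (E : {fset B}) :
  {subset msupp x <= E} -> lin f x = \sum_(b <- E) x@_b *: f b.
Proof.
move=> /fsubsetP sxE; apply: big_fset_incl => // b _ bx.
by rewrite mcoeff_outdom ?scale0r.
Qed.

Lemma lin_is_linear (B : choiceType) (V : lmodType K) (f : B -> V) :
  linear (lin f : {malg K[B]} -> V).
Proof.
move=> c x y; set E := (msupp x `|` msupp y)%fset.
rewrite !(@lin_fset _ _ f _ E).
- rewrite scaler_sumr -big_split /=; apply: eq_bigr => b _.
  by rewrite mcoeffD mcoeffZ scalerDl scalerA.
- by move=> b; rewrite !inE => ->; rewrite orbT.
- by move=> b; rewrite !inE => ->.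
move=> b; rewrite !inE -!mcoeff_neq0 mcoeffD mcoeffZ.
by apply: contraNT; rewrite negb_or !negbK => /andP[/eqP-> /eqP->]; rewrite mulr0 addr0.
Qed.

HB.instance Definition _ (B : choiceType) (V : lmodType K) (f : B -> V) :=
  GRing.isLinear.Build K {malg K[B]} V *:%R (lin f) (lin_is_linear f).

Lemma lin_malgU (B : choiceType) (V : lmodType K) (f : B -> V) b :
  lin f << b >> = f b.
Proof. by rewrite /lin msuppU oner_eq0 big_seq_fset1 mcoeffUU scale1r. Qed.

Lemma malg_expand (B : choiceType) (x : {malg K[B]}) :
  x = \sum_(b <- msupp x) x@_b *: << b >>.
Proof.
rewrite {1}(monalgE x); apply: eq_bigr => b _; apply/malgP => k.
by rewrite mcoeffZ !mcoeffU mulr_natr.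
Qed.

Lemma lin_scale_sum (B : choiceType) (V : lmodType K) (f : B -> V)
    (I : Type) (s : seq I) (c : I -> K) (x : I -> {malg K[B]}) :
  lin f (\sum_(i <- s) c i *: x i) = \sum_(i <- s) c i *: lin f (x i).
Proof. by rewrite linear_sum; apply: eq_bigr => i _; rewrite linearZ. Qed.

Lemma linear_malg_ext (B : choiceType) (V : lmodType K)
    (f g : {linear {malg K[B]} -> V}) :
  (forall b, f << b >> = g << b >>) -> f =1 g.
Proof.
move=> fg x; rewrite (malg_expand x) !linear_sum; apply: eq_bigr => b _.
by rewrite !linearZ fg.
Qed.

Lemma linear_lin (B : choiceType) (V W : lmodType K) (g : {linear V -> W})
    (f : B -> V) x : g (lin f x) = lin (fun b => g (f b)) x.
Proof. by rewrite /lin linear_sum; apply: eq_bigr => b _; rewrite linearZ. Qed.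

Lemma eq_lin (B : choiceType) (V : lmodType K) (f g : B -> V) :
  f =1 g -> lin f =1 lin g.
Proof. by move=> fg x; rewrite /lin; apply: eq_bigr => b _; rewrite fg. Qed.

Lemma lin_malgU_id (B : choiceType) (x : {malg K[B]}) :
  lin (fun b => << b >>) x = x.
Proof. by rewrite [RHS]malg_expand. Qed.

Lemma mcoeff_lin (A B : choiceType) (f : A -> {malg K[B]}) x b :
  (lin f x)@_b = \sum_(a <- msupp x) x@_a * (f a)@_b.
Proof.
by rewrite /lin raddf_sum; apply: eq_bigr => a _; rewrite /= mcoeffZ.
Qed.

Lemma mcoeff_expand (B : choiceType) (x : {malg K[B]}) b :
  x@_b = \sum_(a <- msupp x) x@_a * (a == b)%:R.
Proof.
rewrite -{1}(lin_malgU_id x) mcoeff_lin.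
by apply: eq_bigr => a _; rewrite mcoeffU.
Qed.

Lemma linKE (B : choiceType) (f : B -> K) (x : {malg K[B]}) :
  linK f x = lin (V := K^o) f x.
Proof. by []. Qed.

Lemma bilinE (B1 B2 : choiceType) (V : lmodType K) (f : B1 -> B2 -> V) x y :
  bilin f x y = lin (fun b => lin (f b) y) x.
Proof.
rewrite /bilin /lin; apply: eq_bigr => b _; rewrite scaler_sumr.
by apply: eq_bigr => c _; rewrite scalerA.
Qed.

Lemma bilinEr (B1 B2 : choiceType) (V : lmodType K) (f : B1 -> B2 -> V) x y :
  bilin f x y = lin (fun c => lin (f^~ c) x) y.
Proof.
rewrite /bilin /lin exchange_big; apply: eq_bigr => b _; rewrite scaler_sumr.
by apply: eq_bigr => c _; rewrite scalerA mulrC.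
Qed.

Lemma bilin_linearr (B1 B2 : choiceType) (V : lmodType K) (f : B1 -> B2 -> V) x :
  linear (bilin f x).
Proof. by move=> c a b; rewrite !bilinEr linearP. Qed.

HB.instance Definition _ (B1 B2 : choiceType) (V : lmodType K)
    (f : B1 -> B2 -> V) x :=
  GRing.isLinear.Build K {malg K[B2]} V *:%R (bilin f x) (bilin_linearr f x).

Lemma bilin_sumZ (B1 B2 : choiceType) (V : lmodType K) (f : B1 -> B2 -> V)
    (I L : Type) (s : seq I) (t : seq L) (c : I -> K) (d : L -> K) x y :
  bilin f (\sum_(i <- s) c i *: x i) (\sum_(l <- t) d l *: y l)
  = \sum_(i <- s) \sum_(l <- t) (c i * d l) *: bilin f (x i) (y l).
Proof.
rewrite bilinE lin_scale_sum; apply: eq_bigr => i _.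
rewrite -bilinE bilinEr lin_scale_sum scaler_sumr; apply: eq_bigr => l _.
by rewrite -bilinEr scalerA.
Qed.

Lemma bilin_sum (B1 B2 : choiceType) (V : lmodType K) (f : B1 -> B2 -> V)
    (I L : Type) (s : seq I) (t : seq L) x y :
  bilin f (\sum_(i <- s) x i) (\sum_(l <- t) y l)
  = \sum_(i <- s) \sum_(l <- t) bilin f (x i) (y l).
Proof.
rewrite bilinE linear_sum; apply: eq_bigr => i _.
by rewrite /= -bilinE linear_sum.
Qed.

Lemma bilinUU (B1 B2 : choiceType) (V : lmodType K) (f : B1 -> B2 -> V) a b :
  bilin f << a >> << b >> = f a b.
Proof. by rewrite bilinE !lin_malgU. Qed.

Lemma bilinUl (B1 B2 : choiceType) (V : lmodType K) (f : B1 -> B2 -> V) a y :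
  bilin f << a >> y = lin (f a) y.
Proof. by rewrite bilinE lin_malgU. Qed.

Lemma bilinUr (B1 B2 : choiceType) (V : lmodType K) (f : B1 -> B2 -> V) x b :
  bilin f x << b >> = lin (f^~ b) x.
Proof. by rewrite bilinEr lin_malgU. Qed.

Lemma bilin_lin (A1 A2 B1 B2 : choiceType) (V : lmodType K) (F : B1 -> B2 -> V)
    (f : A1 -> {malg K[B1]}) (h : A2 -> {malg K[B2]}) x y :
  bilin F (lin f x) (lin h y) = bilin (fun a b => bilin F (f a) (h b)) x y.
Proof. exact: bilin_sumZ. Qed.

Lemma linear_bilin (B1 B2 : choiceType) (V W : lmodType K) (g : {linear V -> W})
    (f : B1 -> B2 -> V) x y :
  g (bilin f x y) = bilin (fun a b => g (f a b)) x y.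
Proof.
rewrite !bilinE linear_lin; apply: eq_lin => a /=; exact: linear_lin.
Qed.

Lemma eq_bilin (B1 B2 : choiceType) (V : lmodType K) (f g : B1 -> B2 -> V) x y :
  (forall a b, f a b = g a b) -> bilin f x y = bilin g x y.
Proof.
by move=> fg; rewrite !bilinE; apply: eq_lin => a; apply: eq_lin => b.
Qed.

Lemma mcoeff_tens (A B : choiceType) (x : {malg K[A]}) (y : {malg K[B]}) a b :
  (tens x y)@_(a, b) = x@_a * y@_b.
Proof.
rewrite /tens bilinE mcoeff_lin (mcoeff_expand x a) mulr_suml.
apply: eq_bigr => a' _; rewrite -mulrA; congr (_ * _).
rewrite mcoeff_lin (mcoeff_expand y b) mulr_sumr.
apply: eq_bigr => b' _; rewrite mcoeffU xpair_eqE.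
by rewrite mulrCA -natrM mulnb.
Qed.

Lemma mcoeff_tensE (A B : choiceType) (x : {malg K[A]}) (y : {malg K[B]}) p :
  (tens x y)@_p = x@_p.1 * y@_p.2.
Proof. by case: p => a b; apply: mcoeff_tens. Qed.

Lemma tensUU (A B : choiceType) a b :
  tens << a >> << b >> = << (a, b) >> :> {malg K[(A * B)%type]}.
Proof. exact: bilinUU. Qed.

Lemma lin_tens_bilin (A B : choiceType) (V : lmodType K) (f : A * B -> V) x y :
  lin f (tens x y) = bilin (fun a b => f (a, b)) x y.
Proof.
rewrite /tens !bilinE linear_lin; apply: eq_lin => a /=.
by rewrite linear_lin; apply: eq_lin => b /=; rewrite lin_malgU.
Qed.

Definition tensf (A1 A2 B1 B2 : choiceType) (f : A1 -> {malg K[B1]})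
    (g : A2 -> {malg K[B2]}) (p : A1 * A2) := tens (f p.1) (g p.2).

Lemma lin_tensf (A1 A2 B1 B2 : choiceType) (f : A1 -> {malg K[B1]})
    (g : A2 -> {malg K[B2]}) x y :
  lin (tensf f g) (tens x y) = tens (lin f x) (lin g y).
Proof.
rewrite lin_tens_bilin /bilin /tensf /= /lin /tens bilin_sumZ.
by apply: eq_bigr.
Qed.

Lemma lin_tensfK (A B : choiceType) (f : A -> {malg K[B]})
    (g : B -> {malg K[A]}) :
  cancel (lin f) (lin g) -> cancel (lin (tensf f f)) (lin (tensf g g)).
Proof.
move=> fK; apply: (@linear_malg_ext _ _ (lin (tensf g g) \o lin (tensf f f)) idfun).
case=> a b; rewrite /= lin_malgU /tensf lin_tensf /=.
by rewrite -!(lin_malgU f) !fK tensUU.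
Qed.

(** The inverse supplied by [bijective] is a bare function. It agrees with the linear extension of
    its values on basis vectors, because [lin f] is linear and injective. *)
Lemma lin_bijective_inverse (A B : choiceType) (f : A -> {malg K[B]}) :
  bijective (lin f) -> exists g : B -> {malg K[A]},
    cancel (lin f) (lin g) /\ cancel (lin g) (lin f).
Proof.
case=> h fh hf; exists (fun b => h << b >>).
suff hE : lin (fun b => h << b >>) =1 h by split=> x; rewrite hE ?fh ?hf.
move=> x; apply: (can_inj fh); rewrite hf linear_lin -[RHS]lin_malgU_id.
by apply: eq_lin => b; rewrite /= hf.
Qed.

End LinearExtension.

(** * Homogeneous elements and graded maps *)

Section Homogeneous.
Variables (K : fieldType) (B : choiceType) (deg : B -> nat).
Implicit Types x y : {malg K[B]}.

Definition homog n x := forall b, x@_b != 0 -> deg b = n.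

Lemma homogP n x : homog n x <-> forall b, b \in msupp x -> deg b = n.
Proof. by split=> h b; [rewrite -mcoeff_neq0|rewrite mcoeff_neq0]; apply: h. Qed.

Lemma homog_coef0 n x b : homog n x -> deg b != n -> x@_b = 0.
Proof. by move=> hx; apply: contraNeq => /hx ->. Qed.

Lemma homog0 n : homog n 0.
Proof. by move=> b; rewrite mcoeff0 eqxx. Qed.

Lemma homogU b : homog (deg b) << b >>.
Proof. by move=> c; rewrite mcoeffU; case: (b =P c) => [->//|_]; rewrite eqxx. Qed.

Lemma homogD n x y : homog n x -> homog n y -> homog n (x + y).
Proof.
move=> hx hy b; rewrite mcoeffD; have [x0|/hx//] := eqVneq x@_b 0.
by rewrite x0 add0r; apply: hy.
Qed.

Lemma homogZ n c x : homog n x -> homog n (c *: x).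
Proof. by move=> hx b; rewrite mcoeffZ mulf_eq0 negb_or => /andP[_ /hx]. Qed.

Lemma homog_sum n (I : eqType) (s : seq I) (F : I -> {malg K[B]}) :
  (forall i, i \in s -> homog n (F i)) -> homog n (\sum_(i <- s) F i).
Proof.
move=> hF; rewrite big_seq; apply: (big_ind (homog n)) => //.
- exact: homog0.
- by move=> *; apply: homogD.
Qed.

End Homogeneous.

Section GradedLinear.
Variable K : fieldType.

Lemma homog_lin (A B : choiceType) (dA : A -> nat) (dB : B -> nat)
    (f : A -> {malg K[B]}) n x :
  (forall a, dA a = n -> homog dB n (f a)) -> homog dA n x ->
  homog dB n (lin f x).
Proof.
move=> hf hx; apply: homog_sum => a ax; apply/homogZ/hf/hx.
by rewrite mcoeff_neq0.
Qed.

Lemma homog_bilin (A1 A2 B : choiceType) (d1 : A1 -> nat) (d2 : A2 -> nat)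
    (dB : B -> nat) (f : A1 -> A2 -> {malg K[B]}) n m x y :
  (forall a b, homog dB (d1 a + d2 b)%N (f a b)) -> homog d1 n x ->
  homog d2 m y -> homog dB (n + m) (bilin f x y).
Proof.
move=> hf hx hy; apply: homog_sum => a ax; apply: homog_sum => b yb.
apply: homogZ; rewrite -(hx a) ?mcoeff_neq0 // -(hy b) ?mcoeff_neq0 //.
Qed.

Lemma graded_mapP (A B : choiceType) (dA : A -> nat) (dB : B -> nat)
    (f : A -> {malg K[B]}) :
  graded_map dA dB f <-> forall a, homog dB (dA a) (f a).
Proof. by split=> h a; [apply/homogP=> c; apply: h | move=> c; move: c; apply/homogP]. Qed.

Definition homog_part (B : choiceType) (deg : B -> nat) n (x : {malg K[B]}) :=
  \sum_(b <- msupp x | deg b == n) x@_b *: << b >> : {malg K[B]}.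

Lemma mcoeff_homog_part (B : choiceType) (deg : B -> nat) n (x : {malg K[B]}) b :
  (homog_part deg n x)@_b = if deg b == n then x@_b else 0.
Proof.
rewrite /homog_part raddf_sum /=.
transitivity (\sum_(c <- msupp x | deg c == n) x@_c * (c == b)%:R).
  by apply: eq_bigr => c _; rewrite mcoeffZ mcoeffU.
case: ifP => db; last first.
  rewrite big1 // => c /eqP dc; case: eqP => [cb|_]; last by rewrite mulr0.
  by rewrite -cb dc eqxx in db.
rewrite (mcoeff_expand x) [RHS](bigID (fun c => deg c == n)) /=.
rewrite [X in _ + X]big1 ?addr0 // => c dc.
by case: (c =P b) dc => [->|]; rewrite ?db ?mulr0.
Qed.

(** Let [x] be the preimage of [b] and [x0] its part in the degree of [b]. The image of [x - x0] has
    no component in that degree, since [x - x0] has none, and no component elsewhere, since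
    [<< b >>] and the image of [x0] are homogeneous. By injectivity [x = x0]. *)
Lemma graded_inverse (A B : choiceType) (dA : A -> nat) (dB : B -> nat)
    (f : A -> {malg K[B]}) (g : B -> {malg K[A]}) :
  graded_map dA dB f -> cancel (lin f) (lin g) -> cancel (lin g) (lin f) ->
  graded_map dB dA g.
Proof.
move=> /graded_mapP hf fK gK; apply/graded_mapP => b.
set x := g b; set x0 := homog_part dA (dB b) x.
have hx0 : homog dA (dB b) x0.
  by move=> a; rewrite mcoeff_homog_part; case: (dA a =P dB b) => //; rewrite eqxx.
have fx : lin f x = << b >> by rewrite -[RHS]gK lin_malgU.
suff -> : x = x0 by [].
apply/eqP; rewrite -subr_eq0; apply/eqP; rewrite -[LHS]fK.
suff -> : lin f (x - x0) = 0 by rewrite linear0.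
apply/malgP => c; rewrite mcoeff0; have [cb|cb] := eqVneq (dB c) (dB b).
  rewrite mcoeff_lin big_seq big1 // => a; rewrite -mcoeff_neq0 mcoeffB.
  rewrite mcoeff_homog_part; have [dab|dab _] := eqVneq (dA a) (dB b).
    by rewrite subrr eqxx.
  by rewrite (homog_coef0 (hf a)) ?mulr0 // cb eq_sym.
rewrite linearB /= fx; apply: (homog_coef0 (n := dB b) (deg := dB)) cb.
apply: homogD; first exact: homogU.
rewrite -scaleN1r; apply/homogZ/(homog_lin (dA := dA)) => // a <-.
exact: hf.
Qed.

End GradedLinear.

(** * Coordinates and matrices on finite lists of basis vectors *)

Section Coordinates.
Variable K : fieldType.

Definition supported (T : choiceType) (s : seq T) (x : {malg K[T]}) :=
  forall b, x@_b != 0 -> b \in s.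

Lemma lin_supported (B : choiceType) (V : lmodType K) (f : B -> V)
    (x : {malg K[B]}) (s : seq B) :
  uniq s -> supported s x -> lin f x = \sum_(b <- s) x@_b *: f b.
Proof.
move=> us xs; rewrite (@lin_fset _ _ _ f x [fset b in s]%fset); last first.
  by move=> b; rewrite !inE /= -mcoeff_neq0; apply: xs.
by apply: perm_big; apply: uniq_perm => // b; rewrite ?inE.
Qed.

Lemma lin_eq_supp (B : choiceType) (V : lmodType K) (f g : B -> V)
    (x : {malg K[B]}) :
  (forall b, x@_b != 0 -> f b = g b) -> lin f x = lin g x.
Proof.
move=> fg; rewrite /lin big_seq [RHS]big_seq; apply: eq_bigr => b bx.
by rewrite fg // mcoeff_neq0.
Qed.

(** Vectors are rows and matrices act on the right. The length [n] is kept apart from [size s],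
    which lets it have the form [k + m] required by block matrices; [d] only serves [nth]. *)
Definition vec (T : choiceType) (d : T) n (s : seq T) (v : 'rV[K]_n) : {malg K[T]} :=
  \sum_(i < n) v 0 i *: << nth d s i >>.

Definition coords (T : choiceType) (d : T) n (s : seq T) (x : {malg K[T]}) : 'rV[K]_n :=
  \row_i x@_(nth d s i).

Definition fmat (A B : choiceType) (dA : A) (dB : B) n m (s : seq A) (s' : seq B)
    (f : A -> {malg K[B]}) : 'M[K]_(n, m) :=
  \matrix_(i, j) (f (nth dA s i))@_(nth dB s' j).

Lemma lin_vec (T : choiceType) (V : lmodType K) (d : T) n (s : seq T)
    (v : 'rV_n) (f : T -> V) :
  lin f (vec d s v) = \sum_(i < n) v 0 i *: f (nth d s i).
Proof.
by rewrite linear_sum; apply: eq_bigr => i _; rewrite linearZ /= lin_malgU.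
Qed.

Lemma lin_vec_rows (A B : choiceType) (dA : A) (dB : B) n m (s : seq A) (s' : seq B)
    (f : A -> {malg K[B]}) (P : 'M[K]_(n, m)) (v : 'rV_n) :
  (forall i : 'I_n, f (nth dA s i) = vec dB s' (row i P)) ->
  lin f (vec dA s v) = vec dB s' (v *m P).
Proof.
move=> fE; rewrite lin_vec /vec.
under eq_bigr do rewrite fE /vec scaler_sumr.
rewrite exchange_big; apply: eq_bigr => j _; rewrite mxE scaler_suml.
by apply: eq_bigr => i _; rewrite scalerA mxE.
Qed.

Lemma vec_row1 (T : choiceType) (d : T) n (s : seq T) (i : 'I_n) :
  vec d s (row i 1%:M) = << nth d s i >>.
Proof.
rewrite /vec (bigD1 i) //= !mxE eqxx scale1r big1 ?addr0 // => j ji.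
by rewrite !mxE eq_sym (negPf ji) scale0r.
Qed.

Lemma fmat_cat (A B : choiceType) (dA : A) (dB : B) n k m (s : seq A)
    (s1 s2 : seq B) (f : A -> {malg K[B]}) : size s1 = k ->
  fmat dA dB n (k + m) s (s1 ++ s2) f =
  row_mx (fmat dA dB n k s s1 f) (fmat dA dB n m s s2 f).
Proof.
move=> ss; apply/matrixP => i j; rewrite !mxE nth_cat ss.
by case: splitP => l ->; rewrite mxE // addKn.
Qed.

Section Basis.
Variables (T : choiceType) (d : T) (n : nat) (s : seq T).
Hypotheses (us : uniq s) (ss : size s = n).

Lemma mcoeff_vec_nth (v : 'rV_n) (i : 'I_n) : (vec d s v)@_(nth d s i) = v 0 i.
Proof.
rewrite /vec raddf_sum (bigD1 i) //= mcoeffZ mcoeffU eqxx mulr1 big1 ?addr0 //.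
move=> j ji; rewrite mcoeffZ mcoeffU nth_uniq ?ss // (inj_eq val_inj).
by rewrite (negPf ji) mulr0.
Qed.

Lemma vec_supported (v : 'rV_n) : supported s (vec d s v).
Proof.
move=> b; apply: contraNT => bs; rewrite /vec raddf_sum big1 // => i _ /=.
rewrite mcoeffZ mcoeffU; case: eqP => [e|]; rewrite ?mulr0 //.
by rewrite -e mem_nth ?ss in bs.
Qed.

Lemma coordsK (x : {malg K[T]}) : supported s x -> vec d s (coords d n s x) = x.
Proof.
move=> xs; rewrite -[RHS]lin_malgU_id (lin_supported _ us xs).
rewrite (big_nth d) big_mkord ss; apply: eq_bigr => i _.
by rewrite mxE.
Qed.

Lemma coords_lin (B : choiceType) (dB : B) m (s' : seq B) (f : T -> {malg K[B]}) x :
  supported s x ->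
  coords dB m s' (lin f x) = coords d n s x *m fmat d dB n m s s' f.
Proof.
move=> xs; rewrite (lin_supported _ us xs) (big_nth d) big_mkord ss.
apply/rowP => j; rewrite !mxE raddf_sum; apply: eq_bigr => i _.
by rewrite !mxE /= mcoeffZ.
Qed.

Lemma coords_vec (v : 'rV_n) : coords d n s (vec d s v) = v.
Proof. by apply/rowP => i; rewrite mxE mcoeff_vec_nth. Qed.

Lemma nth_indexE b : b \in s -> exists i : 'I_n, b = nth d s i.
Proof.
move=> bs; have lt : (index b s < n)%N by rewrite -ss index_mem.
by exists (Ordinal lt); rewrite nth_index.
Qed.

Lemma row_free_fmat (B : choiceType) (dB : B) m (s' : seq B)
    (f : T -> {malg K[B]}) :
  uniq s' -> size s' = m ->
  (forall x, supported s x -> lin f x = 0 -> x = 0) ->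
  (forall a, a \in s -> supported s' (f a)) ->
  row_free (fmat d dB n m s s' f).
Proof.
move=> us' ss' injf fs; apply: inj_row_free => v vM.
rewrite -(coords_vec v).
suff -> : vec d s v = 0 by apply/rowP => i; rewrite !mxE mcoeff0.
apply: injf; first exact: vec_supported.
apply/malgP => b; rewrite mcoeff0.
have [bs'|bs'] := boolP (b \in s').
  have e : coords dB m s' (lin f (vec d s v)) = 0.
    by rewrite coords_lin ?coords_vec //; apply: vec_supported.
  have lt : (index b s' < m)%N by rewrite -ss' index_mem.
  by have /rowP/(_ (Ordinal lt)) := e; rewrite !mxE nth_index.
rewrite lin_vec raddf_sum big1 // => i _ /=; rewrite mcoeffZ.
have [->|/fs] := eqVneq (f (nth d s i))@_b 0; first by rewrite mulr0.
by rewrite mem_nth ?ss // (negPf bs') => /(_ isT).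
Qed.

End Basis.

End Coordinates.

(** * Counting in graded sets *)

Section Counting.

(** Stated on predicates over possibly infinite types, in the shape of [dim_deg]: [dim_deg deg n m]
    is convertible to [card_is] of the basis vectors of degree [n]. *)
Definition card_is (T : eqType) (P : T -> Prop) (m : nat) :=
  exists s : seq T, [/\ uniq s, size s = m & forall x, P x <-> x \in s].

Lemma card_is_ext (T : eqType) (P Q : T -> Prop) m :
  (forall x, P x <-> Q x) -> card_is P m -> card_is Q m.
Proof.
by move=> PQ [s [us ss Ps]]; exists s; split=> // x; rewrite -PQ.
Qed.

Lemma card_is_inj (T : eqType) (P : T -> Prop) m m' :
  card_is P m -> card_is P m' -> m = m'.
Proof.
move=> [s [us <- Ps]] [s' [us' <- Ps']]; apply: perm_size.
by apply: uniq_perm => // x; apply/idP/idP => [/Ps/Ps'|/Ps'/Ps].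
Qed.

Lemma card_is0 (T : eqType) (P : T -> Prop) : (forall x, ~ P x) -> card_is P 0.
Proof. by move=> nP; exists [::]; split=> // x; split=> // /nP. Qed.

Lemma card_is1 (T : eqType) (y : T) : card_is (fun x => x = y) 1.
Proof. by exists [:: y]; split=> // x; rewrite inE; split=> /eqP. Qed.

Lemma card_isU (T : eqType) (P Q : T -> Prop) m m' :
  (forall x, P x -> ~ Q x) -> card_is P m -> card_is Q m' ->
  card_is (fun x => P x \/ Q x) (m + m')%N.
Proof.
move=> dPQ [s [us <- Ps]] [s' [us' <- Ps']]; exists (s ++ s'); split.
- rewrite cat_uniq us us' andbT; apply/hasPn => x /Ps' Qx.
  by apply/negP => /Ps/dPQ.
- by rewrite size_cat.
- move=> x; rewrite mem_cat; split=> [[/Ps->//|/Ps'->]|]; first by rewrite orbT.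
  by case/orP=> [/Ps|/Ps']; [left|right].
Qed.

Lemma card_is_sum (T : eqType) (P : nat -> T -> Prop) (m : nat -> nat) N :
  (forall k x, (k < N)%N -> P k x -> forall l, (l < N)%N -> P l x -> k = l) ->
  (forall k, (k < N)%N -> card_is (P k) (m k)) ->
  card_is (fun x => exists2 k, (k < N)%N & P k x) (\sum_(k < N) m k)%N.
Proof.
elim: N => [|N IH] dP cP.
  by rewrite big_ord0; apply: card_is0 => x [].
rewrite big_ord_recr /=.
apply: (@card_is_ext _ (fun x => (exists2 k, (k < N)%N & P k x) \/ P N x)).
  move=> x; split=> [[[k kN Pk]|PN]|[k]].
  - by exists k => //; apply: ltnW.
  - by exists N.
  - rewrite ltnS leq_eqVlt => /orP[/eqP->|kN] Pk; first by right.
    by left; exists k.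
apply: card_isU; last exact: cP.
  move=> x [k kN Pk] PN; have := dP k x (ltnW kN) Pk N (ltnSn N) PN.
  by move=> kNE; rewrite kNE ltnn in kN.
apply: IH => [k x kN Pk l lN Pl|k kN]; last by apply/cP/ltnW.
by apply: (dP k x) => //; apply: ltnW.
Qed.

Lemma card_is_prod (S T : eqType) (P : S -> Prop) (Q : T -> Prop) m m' :
  card_is P m -> card_is Q m' ->
  card_is (fun p : S * T => P p.1 /\ Q p.2) (m * m')%N.
Proof.
move=> [s [us <- Ps]] [s' [us' <- Ps']].
exists [seq (x, y) | x <- s, y <- s']; split.
- by apply: allpairs_uniq => // -[? ?] [? ?].
- by rewrite size_allpairs.
- move=> [x y] /=; split=> [[/Ps xs /Ps' ys]|].
    by apply/allpairsP; exists (x, y).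
  by case/allpairsP=> -[x' y'] /= [/Ps Px /Ps' Qy [-> ->]].
Qed.

Lemma card_is_image (S T : eqType) (f : S -> T) (P : S -> Prop) m :
  injective f -> card_is P m ->
  card_is (fun y => exists2 x, P x & y = f x) m.
Proof.
move=> injf [s [us <- Ps]]; exists (map f s); split.
- by rewrite map_inj_uniq.
- by rewrite size_map.
- move=> y; split=> [[x /Ps xs ->]|/mapP[x /Ps Px ->]]; first exact: map_f.
  by exists x.
Qed.

Lemma card_is_preimage (S T : eqType) (f : S -> T) (P : S -> Prop) m :
  injective f -> card_is (fun y => exists2 x, P x & y = f x) m ->
  card_is P m.
Proof.
move=> injf [s [us <- Ps]].
have [s' ss'] : exists s', s = map f s'.
  have : forall y, y \in s -> exists x, y = f x.
    by move=> y /Ps[x _ ->]; exists x.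
  elim: s {us Ps} => [|y s IH] h; first by exists [::].
  have [|s' ->] := IH; first by move=> z zs; apply: h; rewrite inE zs orbT.
  by have [x ->] := h y (mem_head _ _); exists (x :: s').
exists s'; split.
- by rewrite ss' map_inj_uniq in us.
- by rewrite ss' size_map.
- move=> x; rewrite -(mem_map injf) -ss' -Ps.
  by split=> [Px|[x' Px' /injf->]//]; exists x.
Qed.

Lemma card_is_filter (T : eqType) (P : T -> Prop) (q : pred T) m :
  card_is P m -> exists m', card_is (fun x => P x /\ q x) m'.
Proof.
move=> [s [us _ Ps]]; exists (size (filter q s)), (filter q s).
split=> //; first exact: filter_uniq.
by move=> x; rewrite mem_filter andbC; split=> [[/Ps->]|/andP[/Ps]].
Qed.

Lemma card_is_diff (T : eqType) (P : T -> Prop) (q : pred T) m a :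
  card_is P m -> card_is (fun x => P x /\ q x) a ->
  (a <= m)%N /\ card_is (fun x => P x /\ ~~ q x) (m - a).
Proof.
move=> cP ca; have [b cb] := card_is_filter (predC q) cP.
suff -> : m = (a + b)%N by rewrite leq_addr addKn.
apply: (card_is_inj cP).
apply: card_is_ext (card_isU _ ca cb); last by move=> x [_ qx] [_]; rewrite /= qx.
by move=> x; split=> [[[]|[]]//|Px]; case qx: (q x); [left|right; rewrite /= qx].
Qed.

(** Lists in [P] are extended one element at a time; the bound forces this to stop, and a list that
    cannot be extended enumerates [P]. Excluded middle decides whether an extension exists. *)
Lemma card_is_bounded (T : eqType) (P : T -> Prop) N :
  (forall s, uniq s -> (forall x, x \in s -> P x) -> (size s <= N)%N) ->
  exists m, card_is P m.
Proof.
move=> bP.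
suff H k : (k <= N.+1)%N -> (exists m, card_is P m) \/
    exists s, [/\ uniq s, size s = k & forall x, x \in s -> P x].
  have [//|[s [us ss sP]]] := H N.+1 (leqnn _).
  by have := bP s us sP; rewrite ss ltnn.
elim: k => [_|k IH kN]; first by right; exists [::].
have [|[s [us ss sP]]] := IH (ltnW kN); first by left.
have [[x [Px xs]]|nx] := classic (exists x, P x /\ x \notin s).
  right; exists (x :: s); split=> /=; rewrite ?xs ?ss //.
  by move=> y; rewrite inE => /orP[/eqP->//|/sP].
left; exists k, s; split=> // x; split=> [Px|/sP//].
by apply/negPn/negP => xs; apply: nx; exists x.
Qed.

Lemma choose_cards (T : eqType) (P : nat -> T -> Prop) :
  (forall n, exists m, card_is (P n) m) ->
  exists a, forall n, card_is (P n) (a n).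
Proof.
move=> h; exists (fun n => sval (constructive_indefinite_description _ (h n))).
by move=> n; case: constructive_indefinite_description.
Qed.

End Counting.

(** * Words of given degree over a graded alphabet *)

Section WordCounting.
Variables (J : choiceType) (wdeg : J -> nat).
Hypothesis wdeg_gt0 : forall j, (0 < wdeg j)%N.

Local Notation wd := (word_deg wdeg).

Lemma word_deg_cat w1 w2 : wd (w1 ++ w2) = (wd w1 + wd w2)%N.
Proof. by rewrite /word_deg map_cat sumn_cat. Qed.

Lemma word_deg_eq0 w : (wd w == 0)%N = (w == [::]).
Proof. by case: w => //= j w; rewrite /word_deg /= addn_eq0 -leqn0 leqNgt wdeg_gt0. Qed.

Lemma word_deg_gt0 w : (0 < wd w)%N = (w != [::]).
Proof. by rewrite lt0n word_deg_eq0. Qed.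

Lemma word_deg1 j : wd [:: j] = wdeg j.
Proof. by rewrite /word_deg /= addn0. Qed.

Lemma card_letters0 : card_is (fun j => wdeg j = 0%N) 0.
Proof. by apply: card_is0 => j dj; have := wdeg_gt0 j; rewrite dj. Qed.

Lemma card_words0 : card_is (fun w => wd w = 0%N) 1.
Proof.
apply: card_is_ext (card_is1 [::]) => w.
by split=> [->//|/eqP]; rewrite word_deg_eq0 => /eqP.
Qed.

(** Common to words (first letter, rest) and trees (root, children). A head of positive degree
    [k.+1] leaves [n - k]. The hypotheses stop at [n] so that the lemma can be applied while the
    counts are still being built by induction. *)
Lemma card_cons_words (T : eqType) (S : eqType) (dT : T -> nat) (dS : S -> nat)
    (U : eqType) (dU : U -> nat) (c : T * S -> U) n a b :
  injective c -> (forall p, dU (c p) = (dT p.1 + dS p.2)%N) ->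
  (forall t, (0 < dT t)%N) ->
  (forall x, dU x = n.+1 -> exists p, x = c p) ->
  (forall k, (k <= n)%N -> card_is (fun t => dT t = k.+1) (a k.+1)) ->
  (forall k, (k <= n)%N -> card_is (fun s => dS s = k) (b k)) ->
  card_is (fun x => dU x = n.+1) (\sum_(k < n.+1) a k.+1 * b (n - k))%N.
Proof.
move=> injc dc dT0 surjc ca cb.
pose P k (x : U) := exists2 p, dT p.1 = k.+1 /\ dS p.2 = (n - k)%N & x = c p.
apply: (@card_is_ext _ (fun x => exists2 k, (k < n.+1)%N & P k x)).
  move=> x; split=> [[k kn [p [dp1 dp2] ->]]|dx].
    by rewrite dc dp1 dp2; lia.
  have [p xp] := surjc _ dx; exists (dT p.1).-1.
    by move: (dT0 p.1) dx; rewrite xp dc; lia.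
  by exists p => //; move: (dT0 p.1) dx; rewrite xp dc; lia.
apply: (@card_is_sum _ P (fun k => a k.+1 * b (n - k))%N).
  move=> k x _ [p [d1 _] ->] l _ [q [e1 _] /injc pq].
  by move: d1; rewrite pq e1 => -[].
move=> k kn; apply: card_is_image => //.
apply: (@card_is_prod _ _ (fun t => dT t = k.+1) (fun s => dS s = (n - k)%N)).
  exact: ca.
by apply: cb; apply: leq_subr.
Qed.

Lemma card_words_step n a b :
  (forall k, (k <= n)%N -> card_is (fun j => wdeg j = k.+1) (a k.+1)) ->
  (forall k, (k <= n)%N -> card_is (fun w => wd w = k) (b k)) ->
  card_is (fun w => wd w = n.+1) (\sum_(k < n.+1) a k.+1 * b (n - k))%N.
Proof.
apply: (@card_cons_words _ _ wdeg wd _ wd (fun p => p.1 :: p.2)) => //.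
- by move=> [j w] [j' w'] [-> ->].
- by case=> // j w _; exists (j, w).
Qed.

Lemma card_words_rec a b :
  (forall n, card_is (fun j => wdeg j = n) (a n)) ->
  (forall n, card_is (fun w => wd w = n) (b n)) ->
  b 0%N = 1%N /\ forall n, b n.+1 = (\sum_(k < n.+1) a k.+1 * b (n - k))%N.
Proof.
move=> ca cb; split=> [|n]; first exact: card_is_inj (cb 0%N) card_words0.
by apply: card_is_inj (cb n.+1) (card_words_step _ _).
Qed.

Lemma card_letter_words n a :
  card_is (fun j => wdeg j = n) a ->
  card_is (fun w => wd w = n /\ (size w == 1)%N) a.
Proof.
move=> ca.
have inj1 : injective (fun j : J => [:: j]) by move=> x y [].
apply: card_is_ext (card_is_image inj1 ca) => w.
split=> [[j dj ->]|[]]; first by rewrite word_deg1.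
by case: w => [|j []] //; rewrite word_deg1 => dj _; exists j.
Qed.

Lemma card_letters_of_words n b :
  card_is (fun w => wd w = n) b -> exists a, card_is (fun j => wdeg j = n) a.
Proof.
move=> cb.
have [a ca] := card_is_filter (fun w => size w == 1%N) cb; exists a.
apply: (@card_is_preimage _ _ (fun j : J => [:: j])); first by move=> x y [].
apply: card_is_ext ca => w.
split=> [[]|[j dj ->]]; last by rewrite word_deg1.
by case: w => [|j []] //; rewrite word_deg1 => dj _; exists j.
Qed.

Lemma card_long_words n a b : (0 < n)%N ->
  card_is (fun j => wdeg j = n) a -> card_is (fun w => wd w = n) b ->
  (a <= b)%N /\ card_is (fun w => wd w = n /\ (1 < size w)%N) (b - a).
Proof.
move=> n0 /card_letter_words ca cb; have [-> cd] := card_is_diff cb ca; split=> //.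
apply: card_is_ext cd => w; split=> -[dw sw]; split=> //.
  by case: w dw sw => [d0|j [|]] //; rewrite -d0 in n0.
by case: w sw {dw} => [|j []].
Qed.

(** Listing one-letter words before longer ones produces the block structure of the matrices. It
    applies to words in letters, to words in free generators and to forests, which are words in
    trees. *)
Lemma word_basis n a b : (0 < n)%N ->
  card_is (fun j => wdeg j = n) a -> card_is (fun w => wd w = n) b ->
  exists s1 s2 : seq (seq J),
    [/\ size s1 = a, size s2 = (b - a)%N, uniq (s1 ++ s2),
        forall w, (w \in s1) = (wd w == n) && (size w == 1)%N
      & forall w, (w \in s2) = (wd w == n) && (1 < size w)%N].
Proof.
move=> n0 ca cb; have [_ [s2 [u2 e2 h2]]] := card_long_words n0 ca cb.
have [s1 [u1 e1 h1]] := card_letter_words ca.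
have m1 w : (w \in s1) = (wd w == n) && (size w == 1)%N.
  by apply/idP/andP => [/h1[-> ->]//|[/eqP dw sw]]; apply/h1.
have m2 w : (w \in s2) = (wd w == n) && (1 < size w)%N.
  by apply/idP/andP => [/h2[-> ->]//|[/eqP dw sw]]; apply/h2.
exists s1, s2; split=> //; rewrite cat_uniq u1 u2 andbT; apply/hasPn => w.
rewrite m2 => /andP[_ sw]; apply/negP => w1; have : w \in s1 by [].
by rewrite m1 (gtn_eqF sw) andbF.
Qed.

Lemma mem_word_basis n (s1 s2 : seq (seq J)) : (0 < n)%N ->
  (forall w, (w \in s1) = (wd w == n) && (size w == 1)%N) ->
  (forall w, (w \in s2) = (wd w == n) && (1 < size w)%N) ->
  forall w, (w \in s1 ++ s2) = (wd w == n).
Proof.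
move=> n0 m1 m2 w; rewrite mem_cat m1 m2 -andb_orr.
by case: w => [|j [|j' w]] /=; rewrite ?andbT ?andbF // eq_sym gtn_eqF.
Qed.

End WordCounting.

(** Since [b 0 = 1], the last term of each sum is the new unknown [a n.+1]; the others agree by
    induction. *)
Lemma convolution_inj (a a' b : nat -> nat) : b 0%N = 1%N ->
  (forall n, \sum_(k < n.+1) a k.+1 * b (n - k)
           = \sum_(k < n.+1) a' k.+1 * b (n - k))%N ->
  forall n, a n.+1 = a' n.+1.
Proof.
move=> b0 ab; elim/ltn_ind => n IH.
have := ab n; rewrite !big_ord_recr /= subnn b0 !muln1.
have -> : (\sum_(i < n) a i.+1 * b (n - i) = \sum_(i < n) a' i.+1 * b (n - i))%N.
  by apply: eq_bigr => i _; rewrite IH.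
exact: addnI.
Qed.

(** The letters satisfy the same convolution recursion against [b] as [t] does. With [t] the number
    of trees, this equates letters, and free generators, with trees in each degree. *)
Lemma card_letters_determined (J : choiceType) (wdeg : J -> nat) (b t : nat -> nat) :
  (forall j, (0 < wdeg j)%N) ->
  (forall n, card_is (fun w => word_deg wdeg w = n) (b n)) ->
  (forall n, b n.+1 = \sum_(k < n.+1) t k.+1 * b (n - k))%N -> t 0%N = 0%N ->
  forall n, card_is (fun j => wdeg j = n) (t n).
Proof.
move=> wdeg_gt0 cb bt t0.
have [a ca] := choose_cards (fun n => card_letters_of_words (cb n)).
have [b0 ba] := card_words_rec wdeg_gt0 ca cb.
have at_ := convolution_inj b0 (fun n => etrans (esym (ba n)) (bt n)).
by case=> [|n]; [rewrite t0; apply: card_letters0 | rewrite -at_].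
Qed.

(** * Invariance of graded dimensions *)

Section GradedDimension.
Variable K : fieldType.

Lemma size_indep_le (A B : choiceType) (f : A -> {malg K[B]}) (s : seq A)
    (s' : seq B) :
  injective (lin f) -> uniq s ->
  (forall a, a \in s -> forall b, (f a)@_b != 0 -> b \in s') ->
  (size s <= size s')%N.
Proof.
move=> injf us fs.
case: s us fs => [//|a0 s0]; set s := a0 :: s0 => us fs.
(* An empty [s'] has no default element for [fmat]; in that case [f] kills a basis vector, against
   injectivity. *)
case: s' fs => [|b0 s'0] fs.
  have f0 : f a0 = 0.
    apply/malgP => b; rewrite mcoeff0; apply/eqP.
    by rewrite -[_ == _]negbK; apply/negP => /(fs a0 (mem_head _ _)).
  have /(congr1 (fun x => x@_a0)) : << a0 >> = 0 :> {malg K[A]}.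
    by apply: injf; rewrite lin_malgU linear0.
  by rewrite mcoeffUU mcoeff0 => /eqP; rewrite oner_eq0.
set s' := b0 :: s'0 in fs *.
wlog us' : s' fs / uniq s' => [H|].
  apply: (leq_trans (H (undup s') _ (undup_uniq _))); last exact: size_undup.
  by move=> a as_ b fab; rewrite mem_undup; apply: fs fab.
have: row_free (fmat a0 b0 (size s) (size s') s s' f).
  apply: row_free_fmat => // x _ fx0; apply: injf.
  by rewrite fx0 linear0.
by rewrite /row_free => /eqP <-; apply: rank_leq_col.
Qed.

(** Finiteness of the degree [n] part of the target is not given. Injectivity of the inverse bounds
    every list of its basis vectors by [m], so an enumeration exists; independence in both
    directions then equates the sizes. *)
Lemma dim_deg_iso (A B : choiceType) (dA : A -> nat) (dB : B -> nat)
    (f : A -> {malg K[B]}) n m :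
  graded_map dA dB f -> bijective (lin f) ->
  dim_deg dA n m -> dim_deg dB n m.
Proof.
move=> gf bijf [s [us ss sA]].
have [g [fK gK]] := lin_bijective_inverse bijf.
have gg := graded_inverse gf fK gK.
have [m' [s' [us' ss' sB]]] : exists m, card_is (fun b => dB b = n) m.
  apply: (@card_is_bounded _ _ m) => s' us' sB; rewrite -ss.
  apply: (size_indep_le (can_inj gK) us') => b /sB db a.
  by rewrite mcoeff_neq0 => /gg; rewrite db => /sA.
exists s'; split=> //; apply/eqP; rewrite -ss eqn_leq; apply/andP; split.
  apply: (size_indep_le (can_inj gK) us') => b /sB db a.
  by rewrite mcoeff_neq0 => /gg; rewrite db => /sA.
apply: (size_indep_le (can_inj fK) us) => a /sA da b.
by rewrite mcoeff_neq0 => /gf; rewrite da => /sB.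
Qed.

Lemma dim_deg_iso_inv (A B : choiceType) (dA : A -> nat) (dB : B -> nat)
    (f : A -> {malg K[B]}) n m :
  graded_map dA dB f -> bijective (lin f) ->
  dim_deg dB n m -> dim_deg dA n m.
Proof.
move=> gf bijf; have [g [fK gK]] := lin_bijective_inverse bijf.
by apply: dim_deg_iso (graded_inverse gf fK gK) _; exists (lin f).
Qed.

End GradedDimension.

(** * The polynomials [D_n] *)

Section TruncatedSeries.
Implicit Types (p q : {poly int}) (N : nat).

(** Congruence modulo ['X^N], which replaces power series by truncated polynomials. *)
Definition eqmodX N p q := exists s, p - q = s * 'X^N.

Lemma eqmodX_coef N p q i : eqmodX N p q -> (i < N)%N -> p`_i = q`_i.
Proof.
move=> [s pq] iN; apply/eqP; rewrite -subr_eq0 -coefB pq.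
by rewrite coefMXn iN.
Qed.

Lemma coef_eqmodX N p q : (forall i, (i < N)%N -> p`_i = q`_i) -> eqmodX N p q.
Proof.
move=> pq; exists (drop_poly N (p - q)).
rewrite -[LHS](poly_take_drop N) [X in X + _](_ : _ = 0) ?add0r //.
apply/polyP => i; rewrite coef_take_poly coef0; case: ifP => // iN.
by rewrite coefB pq ?subrr.
Qed.

Lemma eqmodX_sym N p q : eqmodX N p q -> eqmodX N q p.
Proof. by move=> [s e]; exists (- s); rewrite mulNr -e opprB. Qed.

Lemma eqmodX_trans N q p r : eqmodX N p q -> eqmodX N q r -> eqmodX N p r.
Proof. by move=> [s e] [s' e']; exists (s + s'); rewrite mulrDl -e -e'; ring. Qed.

Lemma eqmodXM N p q p' q' :
  eqmodX N p q -> eqmodX N p' q' -> eqmodX N (p * p') (q * q').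
Proof.
move=> [s e] [s' e']; exists (s * p' + q * s').
have -> : p = q + s * 'X^N by rewrite -e; ring.
have -> : p' = q' + s' * 'X^N by rewrite -e'; ring.
ring.
Qed.

Lemma eqmodX_refl N p : eqmodX N p p.
Proof. by exists 0; rewrite subrr mul0r. Qed.

Lemma eqmodXMl N c p q : eqmodX N p q -> eqmodX N (c * p) (c * q).
Proof. exact/eqmodXM/eqmodX_refl. Qed.

Definition gen (r : nat -> int) N : {poly int} := \sum_(1 <= j < N.+1) r j *: 'X^j.

Lemma coef_gen r N i : (gen r N)`_i = if (0 < i <= N)%N then r i else 0.
Proof.
rewrite /gen coef_sum; case: ifP => iN; last first.
  rewrite big_nat big1 // => j; rewrite ltnS => jN.
  by rewrite coefZ coefXn; case: eqP iN => [->|]; rewrite ?jN ?mulr0.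
rewrite (bigD1_seq i) ?mem_index_iota ?iota_uniq //=.
rewrite coefZ coefXn eqxx mulr1 big1 ?addr0 // => j ji.
by rewrite coefZ coefXn eq_sym (negPf ji) mulr0.
Qed.

Lemma gen_factorX r N : exists q, gen r N = 'X * q.
Proof.
exists (drop_poly 1 (gen r N)); rewrite mulrC -{1}[LHS](poly_take_drop 1) expr1.
rewrite [X in X + _](_ : _ = 0) ?add0r //; apply/polyP => -[|i].
  by rewrite coef_take_poly /= coef_gen coef0.
by rewrite coef_take_poly /= coef0.
Qed.

Lemma geometric_inverse (P : {poly int}) N :
  (exists q, P = 'X * q) -> exists G, eqmodX N (G * (1 + P)) 1.
Proof.
move=> [q Pq]; exists (\sum_(k < N) (- P) ^+ k), (- (- q) ^+ N).
set S := \sum_(k < N) _.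
have -> : S * (1 + P) = 1 - (- P) ^+ N.
  by rewrite -opprB subrX1 -/S; ring.
have -> : (- P) ^+ N = (- q) ^+ N * 'X^N by rewrite -exprMn Pq; congr (_ ^+ _); ring.
ring.
Qed.

Definition Dseries (P : {poly int}) N : {poly int} :=
  \sum_(1 <= k < N.+1) (((-1) ^+ k.+1 * k%:R) : int) *: P ^+ k.

(** Keeping the exact remainder lets the induction go through. It is divisible by [P ^+ N.+1], hence
    by ['X^N.+1] when [P] has no constant term. *)
Lemma DseriesM (P : {poly int}) N :
  Dseries P N * (1 + P) ^+ 2
  = P - (-1) ^+ N * (N.+1%:R * P ^+ N.+1 + N%:R * P ^+ N.+2).
Proof.
elim: N => [|N IH].
  by rewrite /Dseries big_geq // !expr0 expr1; ring.
rewrite /Dseries big_nat_recr //= -/(Dseries P N) mulrDl IH.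
rewrite -mul_polyC rmorphM rmorphXn rmorphN1 rmorph_nat.
rewrite !exprS -!natr1; ring.
Qed.

Lemma eqmodX_Dseries (P : {poly int}) N :
  (exists q, P = 'X * q) -> eqmodX N.+1 (Dseries P N * (1 + P) ^+ 2) P.
Proof.
move=> [q Pq]; rewrite DseriesM.
exists (- (-1) ^+ N * q ^+ N.+1 * (N.+1%:R + N%:R * P)).
rewrite (exprS P N.+1) [in P ^+ N.+1]Pq exprMn; ring.
Qed.

(** Here [f], [t] and [d] count forests, trees and decorations. The recursions give
    [E * (1 + P) ^+ 2 = P] modulo ['X^n.+1], which [Dseries P n] also satisfies; the truncated
    inverse [G] of [1 + P] cancels the square. *)
Lemma Dpoly_int_unique (f t d : nat -> nat) :
  (forall n, f n.+1 = \sum_(k < n.+1) t k.+1 * f (n - k))%N ->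
  (forall n, t n.+1 = \sum_(k < n.+1) d k.+1 * f (n - k))%N ->
  f 0%N = 1%N ->
  forall n, (0 < n)%N -> Dpoly_int (fun j => (f j)%:Z) n = (d n)%:Z.
Proof.
move=> ft td f0 n n0.
rewrite /Dpoly_int -/(gen (fun j => (f j)%:Z) n) -/(Dseries _ n).
set P := gen _ n.
pose T := gen (fun j => (t j)%:Z) n; pose E := gen (fun j => (d j)%:Z) n.
have FE i : (i <= n)%N -> (1 + P)`_i = (f i)%:Z.
  rewrite coefD coef1 coef_gen; case: i => [|i] ilen /=; first by rewrite f0.
  by rewrite ilen add0r.
have conv (a b : nat -> nat) : (forall m, b m.+1 = \sum_(k < m.+1) a k.+1 * f (m - k))%N ->
    eqmodX n.+1 (gen (fun j => (a j)%:Z) n * (1 + P)) (gen (fun j => (b j)%:Z) n).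
  move=> ab; apply: coef_eqmodX => i; rewrite ltnS => ilen.
  rewrite coefM coef_gen; case: i ilen => [|i] ilen /=.
    by rewrite big_ord1 coef_gen mul0r.
  rewrite ilen ab [LHS]big_ord_recl coef_gen mul0r add0r.
  rewrite (big_morph Posz PoszD (erefl 0%:Z)); apply: eq_bigr => k _.
  rewrite PoszM coef_gen FE; last by rewrite /= /bump; lia.
  by rewrite /= /bump /= add1n subSS (leq_trans _ ilen).
have TP : eqmodX n.+1 (T * (1 + P)) P by apply: conv.
have ET : eqmodX n.+1 (E * (1 + P)) T by apply: conv.
have [G GF] := geometric_inverse n.+1 (gen_factorX (fun j => (f j)%:Z) n).
rewrite -/P in GF.
have EP : eqmodX n.+1 (E * (1 + P) ^+ 2) P.
  rewrite expr2 mulrA; apply: eqmodX_trans TP; apply: eqmodXM ET _.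
  exact: eqmodX_refl.
have cancelF A : eqmodX n.+1 (A * (1 + P) ^+ 2) P -> eqmodX n.+1 A (G ^+ 2 * P).
  move=> AP; apply: eqmodX_trans (eqmodXMl (G ^+ 2) AP).
  rewrite mulrC -mulrA -exprMn [_ * G]mulrC -{1}[A]mulr1; apply: eqmodXMl.
  rewrite -[X in eqmodX _ X]mulr1 expr2; apply/eqmodX_sym/eqmodXM => //.
have DE := eqmodX_trans (cancelF _ (eqmodX_Dseries n (gen_factorX _ n)))
  (eqmodX_sym (cancelF _ EP)).
by rewrite (eqmodX_coef DE) // coef_gen n0 leqnn.
Qed.

Lemma gen_diff (f r : nat -> int) n : (0 < n)%N ->
  (forall k, (0 < k < n)%N -> f k = r k) ->
  gen f n - gen r n = (f n - r n)%:P * 'X^n.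
Proof.
move=> n0 fr; apply/polyP => i; rewrite coefB !coef_gen coefCM coefXn.
have [->|ni] := eqVneq i n; first by rewrite n0 leqnn mulr1.
rewrite mulr0; case: ifP => [iN|]; last by rewrite subrr.
by rewrite fr ?subrr //; lia.
Qed.

(* [D_n] is [R_n] plus a polynomial in the previous variables. *)
Lemma Dpoly_int_inj (f r : nat -> int) :
  (forall n, (0 < n)%N -> Dpoly_int f n = Dpoly_int r n) ->
  forall n, (0 < n)%N -> f n = r n.
Proof.
move=> fr; elim/ltn_ind => n IH n0; have := fr n n0.
rewrite /Dpoly_int -/(gen f n) -/(gen r n) => /eqP; rewrite -subr_eq0 -coefB.
have e : gen f n - gen r n = (f n - r n)%:P * 'X^n.
  by apply: gen_diff => // k /andP[k0 kn]; apply: IH.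
have [q fq] := gen_factorX f n; have [q' rq'] := gen_factorX r n.
have pow k : exists s, gen f n ^+ k - gen r n ^+ k = s * 'X^n.
  by exists ((f n - r n)%:P * \sum_(i < k) gen f n ^+ (k.-1 - i) * gen r n ^+ i);
    rewrite subrXX e mulrAC.
(* From the second power on, the difference gains a factor ['X], because neither series has a
   constant term. Only the linear term reaches degree [n]. *)
have pow2 k : (gen f n ^+ k.+2 - gen r n ^+ k.+2)`_n = 0.
  have [s sE] := pow k.+1.
  have -> : gen f n ^+ k.+2 - gen r n ^+ k.+2 =
    (q * s + (f n - r n)%:P * q' * gen r n ^+ k) * 'X^(n.+1).
    transitivity (gen f n * (gen f n ^+ k.+1 - gen r n ^+ k.+1) +
       (gen f n - gen r n) * (gen r n ^+ k.+1)).
      by rewrite !(exprS _ k.+1); ring.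
    by rewrite sE e !(exprS _ k) {1}fq {1}rq' [X in _ = _ * X]exprS; ring.
  by rewrite coefMXn ltnSn.
rewrite -sumrB coef_sum big_nat_recl //= [X in _ + X]big_nat big1 => [|k].
  rewrite addr0 !expr1 -scalerBr e coefZ coefMXn ltnn subnn coefC eqxx.
  by rewrite expr2 mulrNN !mulr1 !mul1r subr_eq0 => /eqP.
by rewrite -scalerBr coefZ; case: k => // k _; rewrite pow2 mulr0.
Qed.

End TruncatedSeries.

(** * Admissible cuts of planar forests *)

Section PlanarForests.
Variables (D : choiceType) (dg : D -> nat).
Hypothesis dg_gt0 : forall d, (0 < dg d)%N.
Implicit Types (F G : forest D) (t : ptree D).

(** The children of a root form a forest, so a predicate on forests alone suffices: one hypothesis
    for what lies below the first root, one for the remaining trees. *)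
Lemma forest_ind (P : forest D -> Prop) :
  P [::] -> (forall d ts F, P ts -> P F -> P (PNode d ts :: F)) ->
  forall F, P F.
Proof.
move=> P0 Pc.
have Pt : forall t F, P F -> P (t :: F).
  fix IH 1 => -[d ts] F; apply: Pc.
  by elim: ts => [|t ts IHts]; [exact: P0 | exact: IH].
by elim=> [|t F IHF]; [exact: P0 | exact: Pt].
Qed.

(** Identifies the fixpoint nested inside [cutsT] with the global [cutsF]. *)
Lemma cutsT_node d ts :
  cutsT (PNode d ts) = ([:: PNode d ts], [::]) ::
    [seq (p.1, [:: PNode d p.2]) | p <- cutsF ts] :> seq (forest D * forest D).
Proof.
rewrite /=; congr (_ :: map _ _); elim: ts => //= t ts -> //.
Qed.

Lemma cutsF_cons (t : ptree D) F :
  cutsF (t :: F) = [seq (p.1 ++ q.1, p.2 ++ q.2) | p <- cutsT t, q <- cutsF F].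
Proof. by []. Qed.

Local Arguments cutsF : simpl never.
Local Arguments cutsT : simpl never.
Local Arguments tdeg : simpl never.

Lemma tdeg_node d ts : tdeg dg (PNode d ts) = (dg d + nck_deg dg ts)%N.
Proof. by []. Qed.

Lemma tdeg_gt0 t : (0 < tdeg dg t)%N.
Proof. by case: t => d ts; rewrite tdeg_node ltn_addr. Qed.

Lemma nck_deg_cons t F : nck_deg dg (t :: F) = (tdeg dg t + nck_deg dg F)%N.
Proof. by []. Qed.

(** [nck_deg dg] is convertible to [word_deg (tdeg dg)], so lemmas on words apply directly to
    forests. *)
Lemma nck_deg_cat F G : nck_deg dg (F ++ G) = (nck_deg dg F + nck_deg dg G)%N.
Proof. exact: word_deg_cat. Qed.

Lemma nck_deg_eq0 F : (nck_deg dg F == 0)%N = (F == [::]).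
Proof. exact: (word_deg_eq0 tdeg_gt0). Qed.

Lemma nck_deg_gt0 F : (0 < nck_deg dg F)%N = (F != [::]).
Proof. by rewrite lt0n nck_deg_eq0. Qed.

Lemma mem_cutsF_cons (t : ptree D) F c : c \in cutsF (t :: F) ->
  exists p q, [/\ p \in cutsT t, q \in cutsF F & c = (p.1 ++ q.1, p.2 ++ q.2)].
Proof.
by rewrite cutsF_cons => /allpairsP[[p q] /= [pt qF ->]]; exists p, q.
Qed.

Lemma mem_cutsT (d : D) ts p : p \in cutsT (PNode d ts) ->
  p = ([:: PNode d ts], [::]) \/
  exists2 q, q \in cutsF ts & p = (q.1, [:: PNode d q.2]).
Proof.
by rewrite cutsT_node inE => /orP[/eqP|/mapP]; [left|right].
Qed.

Lemma cuts_deg F p : p \in cutsF F ->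
  (nck_deg dg p.1 + nck_deg dg p.2)%N = nck_deg dg F.
Proof.
elim/forest_ind: F p => [|d ts F IHts IHF] p; first by rewrite inE => /eqP->.
case/mem_cutsF_cons=> q [q' [/mem_cutsT qt /IHF e ->]] /=.
rewrite !nck_deg_cat nck_deg_cons tdeg_node -e.
have nil0 : nck_deg dg [::] = 0%N by [].
case: qt => [->|[c /IHts e' ->]]; rewrite [in LHS]/= !nck_deg_cons tdeg_node nil0.
  by rewrite addn0 add0n addnA.
rewrite -e'; move: (nck_deg _ c.1) (nck_deg _ c.2) (nck_deg _ q'.1) (nck_deg _ q'.2).
by move=> *; lia.
Qed.

Section CutSums.
Variable V : nmodType.

Lemma sum_cutsF_cons (h : forest D * forest D -> V) t F :
  \sum_(c <- cutsF (t :: F)) h c =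
  \sum_(p <- cutsT t) \sum_(q <- cutsF F) h (p.1 ++ q.1, p.2 ++ q.2).
Proof. by rewrite cutsF_cons big_allpairs_dep. Qed.

Lemma sum_cutsF_cat (h : forest D * forest D -> V) F G :
  \sum_(c <- cutsF (F ++ G)) h c =
  \sum_(p <- cutsF F) \sum_(q <- cutsF G) h (p.1 ++ q.1, p.2 ++ q.2).
Proof.
elim: F h => [|t F IH] h.
  by rewrite big_seq1 /=; apply: eq_bigr => -[].
rewrite cat_cons !sum_cutsF_cons; apply: eq_bigr => p _.
rewrite IH; apply: eq_bigr => p' _; apply: eq_bigr => q _.
by rewrite /= !catA.
Qed.

Lemma sum_cutsF1 (h : forest D * forest D -> V) t :
  \sum_(c <- cutsF [:: t]) h c = \sum_(p <- cutsT t) h p.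
Proof.
rewrite sum_cutsF_cons; apply: eq_bigr => -[a b] _.
by rewrite big_seq1 /= !cats0.
Qed.

Lemma sum_cutsT (h : forest D * forest D -> V) d ts :
  \sum_(p <- cutsT (PNode d ts)) h p =
  h ([:: PNode d ts], [::]) + \sum_(p <- cutsF ts) h (p.1, [:: PNode d p.2]).
Proof. by rewrite cutsT_node big_cons big_map. Qed.

(** Coassociativity tested against an arbitrary function of the three pieces, which avoids triple
    tensor products. *)
Definition coassoc_at F := forall h : forest D -> forest D -> forest D -> V,
  \sum_(p <- cutsF F) \sum_(q <- cutsF p.2) h p.1 q.1 q.2 =
  \sum_(p <- cutsF F) \sum_(q <- cutsF p.1) h q.1 q.2 p.2.

(** Cuts of [F ++ G] are pairs of cuts. Coassociativity is used on [F] with the cuts of [G] summed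
    inside, then on [G] with the pieces of [F] frozen. *)
Lemma coassoc_cat F G : coassoc_at F -> coassoc_at G -> coassoc_at (F ++ G).
Proof.
move=> cF cG h; rewrite !sum_cutsF_cat.
transitivity (\sum_(p <- cutsF F) \sum_(p' <- cutsF p.2)
   \sum_(q <- cutsF G) \sum_(q' <- cutsF q.2)
     h (p.1 ++ q.1) (p'.1 ++ q'.1) (p'.2 ++ q'.2)).
  apply: eq_bigr => p _; rewrite exchange_big; apply: eq_bigr => q _ /=.
  by rewrite sum_cutsF_cat.
rewrite (cF (fun x y z => \sum_(q <- cutsF G) \sum_(q' <- cutsF q.2)
     h (x ++ q.1) (y ++ q'.1) (z ++ q'.2))).
apply: eq_bigr => p _; rewrite /= [RHS](eq_bigr _ (fun q _ => sum_cutsF_cat _ _ _)).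
rewrite [RHS]exchange_big; apply: eq_bigr => p' _ /=.
exact: (cG (fun x y z => h (p'.1 ++ x) (p'.2 ++ y) (p.2 ++ z))).
Qed.

(** Grafting on a root is a 1-cocycle: the cuts of a tree are the total cut and the cuts of the
    children with the root added to the trunk. The terms with the total cut match, and the rest is
    coassociativity for the children. *)
Lemma cuts_coassoc F : coassoc_at F.
Proof.
elim/forest_ind: F => [|d ts F IHts IHF]; first by move=> h; rewrite !big_seq1.
rewrite -cat1s; apply: coassoc_cat => // h; rewrite !sum_cutsF1 !sum_cutsT /=.
rewrite big_seq1 sum_cutsF1 sum_cutsT /= -addrA; congr (_ + _).
transitivity (\sum_(p <- cutsF ts) (h p.1 [:: PNode d p.2] [::]
   + \sum_(q <- cutsF p.2) h p.1 q.1 [:: PNode d q.2])).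
  by apply: eq_bigr => p _; rewrite sum_cutsF1 sum_cutsT.
rewrite big_split; congr (_ + _).
exact: (IHts (fun x y z => h x y [:: PNode d z])).
Qed.

(** The counit axiom in the form of a sum: exactly one cut prunes nothing. *)
Lemma sum_cuts_nil1 F (h : forest D -> forest D -> V) :
  \sum_(p <- cutsF F) (if p.1 == [::] then h p.1 p.2 else 0) = h [::] F.
Proof.
elim/forest_ind: F h => [|d ts F IHts IHF] h; first by rewrite big_seq1.
rewrite sum_cutsF_cons sum_cutsT /= big1 // add0r.
transitivity (\sum_(p <- cutsF ts) (if p.1 == [::] then
   h p.1 (PNode d p.2 :: F) else 0)); last exact: (IHts (fun x y => h x (PNode d y :: F))).
apply: eq_bigr => -[[|x p1] p2] _ /=; last by rewrite big1.
exact: (IHF (fun x y => h x (PNode d p2 :: y))).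
Qed.

Lemma sum_cuts_nil2 F (h : forest D -> forest D -> V) :
  \sum_(p <- cutsF F) (if p.2 == [::] then h p.1 p.2 else 0) = h F [::].
Proof.
elim: F h => [|[d ts] F IHF] h; first by rewrite big_seq1.
rewrite sum_cutsF_cons sum_cutsT /= [X in _ + X]big1 ?addr0; last first.
  by move=> p _; rewrite big1.
exact: (IHF (fun x y => h (PNode d ts :: x) y)).
Qed.

End CutSums.

Lemma mem_cuts_nil1 F : ([::], F) \in cutsF F.
Proof.
elim/forest_ind: F => [//|d ts F IHts IHF]; rewrite cutsF_cons.
apply/allpairsP; exists (([::], [:: PNode d ts]), ([::], F)); split=> //=.
by rewrite cutsT_node inE; apply/orP; right; apply/mapP; exists ([::], ts).
Qed.

Lemma mem_cuts_nil2 F : (F, [::]) \in cutsF F.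
Proof.
elim: F => [//|[d ts] F IHF]; rewrite cutsF_cons.
apply/allpairsP; exists (([:: PNode d ts], [::]), (F, [::])); split=> //=.
by rewrite cutsT_node inE eqxx.
Qed.

Lemma cuts_nil2 F G : (G, [::]) \in cutsF F -> G = F.
Proof.
elim: F G => [|[d ts] F IHF] G; first by rewrite inE => /eqP[].
case/mem_cutsF_cons=> p [[q1 q2] [/mem_cutsT pt qF [-> e2]]].
case: pt e2 => [->|[c _ ->]] //= e2.
by rewrite -e2 in qF; rewrite (IHF _ qF).
Qed.

Lemma cuts_nil1 F G : ([::], G) \in cutsF F -> G = F.
Proof.
elim/forest_ind: F G => [|d ts F IHts IHF] G; first by rewrite inE => /eqP[].
case/mem_cutsF_cons=> p [[q1 q2] [/mem_cutsT pt qF [e1 ->]]].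
case: pt e1 => [->|[[c1 c2] cts ->]] //=.
case: c1 cts => [|//] /IHts -> /= e1; rewrite -e1 in qF.
by rewrite (IHF _ qF).
Qed.

(** The cut below the first root, which prunes its children and nothing else. *)
Lemma mem_cut_root (d : D) G F :
  (G, PNode d [::] :: F) \in cutsF (PNode d G :: F).
Proof.
rewrite cutsF_cons; apply/allpairsP.
exists ((G, [:: PNode d [::]]), ([::], F)); rewrite /= cats0; split=> //.
  rewrite cutsT_node inE; apply/orP; right; apply/mapP.
  by exists (G, [::]); rewrite ?mem_cuts_nil2.
exact: mem_cuts_nil1.
Qed.

(** If [t] is cut off whole, it is one of the trees of [G], hence smaller. Otherwise its root is [d]
    and all its children are pruned; they make up [G] unless a later tree also contributes, and then
    [t] is again smaller. *)
Lemma cut_root_first d G t F E :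
  (G, PNode d [::] :: F) \in cutsF (t :: E) ->
  t :: E = PNode d G :: F \/ (tdeg dg t < tdeg dg (PNode d G))%N.
Proof.
case: t => d' ts; case/mem_cutsF_cons=> p [[q1 q2] [/mem_cutsT pt qE [-> e2]]].
case: pt e2 => [-> /= _|[[c1 c2] cts -> /=]].
  by right; rewrite !tdeg_node nck_deg_cons tdeg_node; have := dg_gt0 d; lia.
move=> [-> e2 ->]; rewrite -e2 in cts; have -> := cuts_nil2 cts.
have [q10|q1n] := eqVneq q1 [::].
  by left; rewrite q10 cats0; rewrite q10 in qE; rewrite (cuts_nil1 qE).
right; rewrite !tdeg_node nck_deg_cat ltn_add2l -{1}[nck_deg _ ts]addn0.
by rewrite ltn_add2l nck_deg_gt0.
Qed.

End PlanarForests.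

(** * Numbers of trees and forests of given degree *)

Section ForestCounting.
Variables (D : choiceType) (dg : D -> nat).
Hypothesis dg_gt0 : forall d, (0 < dg d)%N.

Lemma card_trees_step n a b :
  (forall k, (k <= n)%N -> card_is (fun d => dg d = k.+1) (a k.+1)) ->
  (forall k, (k <= n)%N -> card_is (fun F => nck_deg dg F = k) (b k)) ->
  card_is (fun t => tdeg dg t = n.+1) (\sum_(k < n.+1) a k.+1 * b (n - k))%N.
Proof.
apply: (@card_cons_words _ _ dg (nck_deg dg) _ (tdeg dg)
  (fun p => PNode p.1 p.2)) => //.
- by move=> [j w] [j' w'] [-> ->].
- by case=> d ts _; exists (d, ts).
Qed.

(** Detaching the root from its children, and placing it in front of them as a tree of its own, is a
    degree-preserving bijection. *)
Lemma card_corolla_forests n a :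
  card_is (fun t => tdeg dg t = n) a ->
  card_is (fun F => nck_deg dg F = n /\ exists d F', F = PNode d [::] :: F') a.
Proof.
move=> ca.
pose c (t : ptree D) : forest D := let: PNode d ts := t in PNode d [::] :: ts.
have injc : injective c by move=> [d ts] [d' ts'] [-> ->].
apply: card_is_ext (card_is_image injc ca) => F; split.
  case=> -[d ts]; rewrite tdeg_node => <- ->; split; last by exists d, ts.
  by rewrite /c nck_deg_cons tdeg_node addn0.
case=> dF [d [F' FE]]; exists (PNode d F'); last by rewrite FE.
by rewrite -dF FE nck_deg_cons !tdeg_node addn0.
Qed.

Lemma card_forests_exist a :
  (forall n, card_is (fun d => dg d = n) (a n)) ->
  exists f t : nat -> nat,
    [/\ forall n, card_is (fun F => nck_deg dg F = n) (f n),
        forall n, card_is (fun T => tdeg dg T = n) (t n),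
        f 0%N = 1%N,
        forall n, f n.+1 = (\sum_(k < n.+1) t k.+1 * f (n - k))%N
      & forall n, t n.+1 = (\sum_(k < n.+1) a k.+1 * f (n - k))%N].
Proof.
move=> ca.
have H n : exists m, card_is (fun F => nck_deg dg F = n) m.
  (* Each new count uses those in all smaller degrees, so the induction carries a function correct
     up to [n]. *)
  suff : exists f : nat -> nat, forall k, (k <= n)%N ->
      card_is (fun F => nck_deg dg F = k) (f k).
    by case=> f cf; exists (f n); apply: cf.
  elim: n => [|n [f cf]].
    exists (fun => 1%N) => k; rewrite leqn0 => /eqP->.
    exact: card_words0 (tdeg_gt0 dg_gt0).
  pose t k := (\sum_(i < k) a i.+1 * f (k.-1 - i))%N.
  have ct k : (k <= n)%N -> card_is (fun T => tdeg dg T = k.+1) (t k.+1).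
    move=> kn; apply: card_trees_step => i ik; first exact: ca.
    by apply: cf; apply: leq_trans kn.
  exists (fun k => if (k <= n)%N then f k
                   else (\sum_(i < n.+1) t i.+1 * f (n - i))%N) => k.
  rewrite leq_eqVlt => /orP[/eqP->|]; last by rewrite ltnS => kn; rewrite kn; apply: cf.
  by rewrite ltnn; apply: card_words_step => //; apply: tdeg_gt0.
have [f cf] := choose_cards H.
have [t ct] := choose_cards (fun n =>
  card_letters_of_words (cf n) : exists m, card_is (fun T => tdeg dg T = n) m).
have [f0 fS] := card_words_rec (tdeg_gt0 dg_gt0) ct cf.
exists f, t; split=> // n.
by apply: card_is_inj (ct n.+1) (card_trees_step _ _) => k _.
Qed.

End ForestCounting.

(** * Completion of block matrices *)

Section MatrixCompletion.
Variable K : fieldType.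

Lemma row_free_mulmx_eq0 m n (A : 'M[K]_(m, n)) p (v : 'M_(p, m)) :
  row_free A -> v *m A = 0 -> v = 0.
Proof. by move=> fA; rewrite -(mul0mx _ A); apply: row_free_inj. Qed.

(* After a change of bases [Y] is [pid_mx r]: the last [k - r] rows of [W] are then
   free, and [X] prescribes the first [r] rows arbitrarily. *)
Lemma mulmx_add_unit k (Y W : 'M[K]_k) :
  row_free (row_mx Y W) -> exists X, Y *m X + W \in unitmx.
Proof.
move=> fYW; set r := \rank Y.
pose E := col_ebase Y; pose U := row_ebase Y.
have uE : E \in unitmx by apply: col_ebase_unit.
have uU : U \in unitmx by apply: row_ebase_unit.
have rk : (r <= k)%N by apply: rank_leq_row.
have YE : Y = E *m pid_mx r *m U by rewrite mulmx_ebase.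
pose W1 := invmx E *m W.
pose V := copid_mx r *m W1.
(* In the bases where [Y] is [pid_mx r], this replaces the first [r] rows of [W1] by those of [Q];
   [V] holds the other rows. *)
suff [Q uQ] : exists Q : 'M[K]_k, pid_mx r *m Q + V \in unitmx.
  exists (invmx U *m (Q - W1)).
  have -> : Y *m (invmx U *m (Q - W1)) + W = E *m (pid_mx r *m Q + V).
    rewrite YE -!mulmxA (mulKVmx uU) mulmxBr -[in LHS](mulKVmx uE W) -/W1.
    rewrite -mulmxDr /V /copid_mx mulmxBl mul1mx; congr (_ *m _).
    by rewrite addrA addrAC.
  by rewrite unitmx_mul uE.
(* If [v *m V = 0], then [v *m copid_mx r *m invmx E] is killed by both [Y] and [W], hence is 0. So
   the kernel of [V] lies in the span of [pid_mx r]. *)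
have rV : \rank V = (k - r)%N.
  apply/eqP; rewrite eqn_leq; apply/andP; split.
    by rewrite -(rank_copid_mx K rk) mxrankM_maxl.
  have : (kermx V <= (pid_mx r : 'M[K]_k))%MS.
    apply/rV_subP => v /sub_kermxP vV.
    have: v *m copid_mx r *m invmx E *m row_mx Y W = 0.
      rewrite mul_mx_row -!mulmxA -/W1 -/V vV YE -!mulmxA (mulKmx uE) !mulmxA.
      by rewrite -(mulmxA v) mul_copid_mx_pid // mulmx0 mul0mx row_mx0.
    move/(row_free_mulmx_eq0 fYW)/(congr1 (mulmx^~ E)).
    rewrite mul0mx mulmxKV // /copid_mx mulmxBr mulmx1 => /eqP.
    by rewrite subr_eq0 => /eqP->; apply: submxMl.
  by move/mxrankS; rewrite mxrank_ker rank_pid_mx // leq_subCl.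
(* The first [r] rows of this [Q] span a complement of the row space of [V]. *)
pose Q := row_ebase V^C%MS; exists Q.
have rC : \rank V^C%MS = r by rewrite mxrank_compl rV subKn.
have QE : (pid_mx r : 'M[K]_k) *m Q = invmx (col_ebase V^C%MS) *m V^C%MS.
  by rewrite -{2}[V^C%MS]mulmx_ebase rC -mulmxA mulKmx // col_ebase_unit.
have QC : (V^C <= (pid_mx r : 'M[K]_k) *m Q)%MS.
  apply/submxP; exists (col_ebase V^C%MS).
  by rewrite QE mulKVmx ?col_ebase_unit.
set A := pid_mx r *m Q + V.
have pA : (pid_mx r : 'M[K]_k) *m A = pid_mx r *m Q.
  rewrite mulmxDr mulmxA pid_mx_id // /V mulmxA mul_pid_mx_copid //.
  by rewrite mul0mx addr0.
have cA : copid_mx r *m A = V.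
  rewrite mulmxDr mulmxA mul_copid_mx_pid // mul0mx add0r /V mulmxA.
  by rewrite copid_mx_id.
rewrite -row_full_unit -sub1mx; apply: submx_trans (_ : (V + V^C <= A)%MS).
  by rewrite sub1mx addsmx_compl_full.
rewrite addsmx_sub -{1}cA submxMl /=; apply: submx_trans QC _.
by rewrite -pA submxMl.
Qed.

(** The left kernel of [col_mx A C] has dimension [k]; let the rows of [row_mx Y Z] be a basis of
    it. A row vector killed by the completed matrix is a combination of them, so it suffices that
    [Y *m X + Z *m B] be invertible. If [v] kills [Y] and [Z *m B], then [v *m Z] kills [B] and,
    because [Y *m A + Z *m C = 0], also [C]; hence [v = 0], as the previous lemma requires. *)
Lemma block_mx_completion k m (A : 'M[K]_(k, m)) (B : 'M_(m, k)) (C : 'M_m) :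
  row_free (row_mx B C) -> row_full (col_mx A C) ->
  exists X, block_mx X A B C \in unitmx.
Proof.
move=> fBC fAC.
have [R fR RN] : exists2 R : 'M[K]_(k, k + m), row_free R &
    (R :=: kermx (col_mx A C))%MS.
  have rN : \rank (kermx (col_mx A C)) = k.
    by rewrite mxrank_ker (eqP fAC) addnK.
  move: (row_base_free (kermx (col_mx A C))) (eq_row_base (kermx (col_mx A C))).
  by move: (row_base _); rewrite rN => R; exists R.
have R0 : R *m col_mx A C = 0 by apply/sub_kermxP; rewrite RN.
pose Y := lsubmx R; pose Z := rsubmx R.
have RE : R = row_mx Y Z by rewrite hsubmxK.
have YZ0 : Y *m A + Z *m C = 0 by rewrite -mul_row_col -RE.
have [|X uX] := @mulmx_add_unit _ Y (Z *m B).
  apply: inj_row_free => v; rewrite mul_mx_row -[0]row_mx0.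
  move=> /eq_row_mx[vY vZB]; apply: (row_free_mulmx_eq0 fR).
  rewrite RE mul_mx_row vY.
  suff -> : v *m Z = 0 by rewrite row_mx0.
  apply: (row_free_mulmx_eq0 fBC); rewrite mul_mx_row -mulmxA vZB.
  suff -> : v *m Z *m C = 0 by rewrite row_mx0.
  have := congr1 (mulmx v) YZ0.
  by rewrite mulmxDr mulmxA vY mul0mx add0r mulmx0 mulmxA.
exists X; rewrite -row_free_unit; apply: inj_row_free => w wE.
have [wXB wAC] : w *m col_mx X B = 0 /\ w *m col_mx A C = 0.
  by apply: eq_row_mx; rewrite row_mx0 -mul_mx_row -block_mxEh.
have /submxP[v wv] : (w <= R)%MS by rewrite RN; apply/sub_kermxP.
suff v0 : v = 0 by rewrite wv v0 mul0mx.
rewrite -row_free_unit in uX; apply: (row_free_mulmx_eq0 uX).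
by rewrite mulmxDr !mulmxA -mul_row_col -mul_mx_row -RE -wv wXB.
Qed.

End MatrixCompletion.

(** * Extension of the isomorphism degree by degree *)

Section Extension.
Variables (K : fieldType) (J : choiceType) (wdeg : J -> nat).
Hypothesis charK0 : [pchar K] =i pred0.
Hypothesis wdeg_gt0 : forall j, (0 < wdeg j)%N.
Variable mu : seq J -> seq J -> {malg K[seq J]}.
Local Notation X := {malg K[seq J]}.
Local Notation wd := (word_deg wdeg).
Local Notation M := (mulH mu).

Hypothesis MA : forall x y z, M (M x y) z = M x (M y z).
Hypothesis M1x : forall x, M << [::] >> x = x.
Hypothesis Mx1 : forall x, M x << [::] >> = x.
Hypothesis Mhom : forall a b, homog wd (wd a + wd b)%N (mu a b).

(* The coproduct of [x] is the sum of the [p.1 (x) p.2] for [p] in [s]: in the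
   basis of words the coefficient of [a (x) b] in it is [x@_(a ++ b)]. *)
Definition has_coprod (x : X) (s : seq (X * X)) :=
  forall a b, x@_(a ++ b) = \sum_(p <- s) p.1@_a * p.2@_b.

Hypothesis Mcop : forall x y s s', has_coprod x s -> has_coprod y s' ->
  has_coprod (M x y) [seq (M p.1 q.1, M p.2 q.2) | p <- s, q <- s'].

Variables (D : choiceType) (dg : D -> nat).
Hypothesis dg_gt0 : forall d, (0 < dg d)%N.
Local Notation nd := (nck_deg dg).
Local Notation forestD := (forest D).

(** Forests are free on trees as an algebra, so [g] determines a multiplicative map. *)
Definition phi (g : ptree D -> X) (F : forestD) : X := word_val mu << [::] >> g F.

Lemma phi_nil g : phi g [::] = << [::] >>. Proof. by []. Qed.

Lemma phi_cons g t F : phi g (t :: F) = M (g t) (phi g F). Proof. by []. Qed.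

Lemma phi1 g t : phi g [:: t] = g t. Proof. by rewrite phi_cons Mx1. Qed.

Lemma phi_cat g F G : phi g (F ++ G) = M (phi g F) (phi g G).
Proof. by elim: F => [|t F IH]; rewrite ?M1x // cat_cons !phi_cons IH MA. Qed.

Lemma eq_phi g g' F : (forall t, t \in F -> g t = g' t) -> phi g F = phi g' F.
Proof.
elim: F => [//|t F IH] h.
have e : phi g F = phi g' F by apply: IH => t' t'F; apply: h; rewrite inE t'F orbT.
by rewrite !phi_cons e (h t (mem_head _ _)).
Qed.

Lemma phi_mulH g x y :
  lin (phi g) (mulH (@nck_mu K D) x y) = M (lin (phi g) x) (lin (phi g) y).
Proof.
rewrite /mulH bilin_lin linear_bilin; apply: eq_bilin => F G.
by rewrite /= lin_malgU phi_cat.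
Qed.

Lemma homogM n m x y : homog wd n x -> homog wd m y -> homog wd (n + m)%N (M x y).
Proof. exact: homog_bilin. Qed.

Lemma homog_nil : homog wd 0 (<< [::] >> : X).
Proof. exact: (@homogU K _ wd [::]). Qed.

Lemma homog_word_val (I : choiceType) (vdeg : I -> nat) (v : I -> X) w :
  (forall i, i \in w -> homog wd (vdeg i) (v i)) ->
  homog wd (word_deg vdeg w) (word_val mu << [::] >> v w).
Proof.
elim: w => [|i w IH] h; first exact: homog_nil.
apply: homogM; first by apply: h; rewrite mem_head.
by apply: IH => j jw; apply: h; rewrite inE jw orbT.
Qed.

Lemma homog_phi g F : (forall t, t \in F -> homog wd (tdeg dg t) (g t)) ->
  homog wd (nd F) (phi g F).
Proof. exact: homog_word_val. Qed.

Definition comult_at (g : ptree D -> X) (F : forestD) :=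
  forall a b, (phi g F)@_(a ++ b) =
    \sum_(p <- cutsF F) (phi g p.1)@_a * (phi g p.2)@_b.

Lemma comult_cat g F G : comult_at g F -> comult_at g G -> comult_at g (F ++ G).
Proof.
move=> cF cG a b; rewrite phi_cat sum_cutsF_cat.
pose h (p : forestD * forestD) := (phi g p.1, phi g p.2).
rewrite (@Mcop _ _ (map h (cutsF F)) (map h (cutsF G))); last 2 first.
- by move=> a' b'; rewrite cF big_map.
- by move=> a' b'; rewrite cG big_map.
rewrite big_allpairs_dep big_map; apply: eq_bigr => p _.
by rewrite big_map; apply: eq_bigr => q _; rewrite !phi_cat.
Qed.

Lemma comult_phi g F : (forall t, t \in F -> comult_at g [:: t]) -> comult_at g F.
Proof.
elim: F => [_ a b|t F IH h].
  rewrite big_seq1 /= !mcoeffU -natrM mulnb; congr (nat_of_bool _)%:R.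
  by case: a => //=; case: b.
rewrite -cat1s; apply: comult_cat; first by apply: h; rewrite mem_head.
by apply: IH => t' t'F; apply: h; rewrite inE t'F orbT.
Qed.

Lemma mem_tdeg_le (F : forestD) t : t \in F -> (tdeg dg t <= nd F)%N.
Proof.
elim: F => // t' F IH; rewrite inE nck_deg_cons => /orP[/eqP->|/IH].
  exact: leq_addr.
by move/leq_trans; apply; apply: leq_addl.
Qed.

Lemma mem_tdeg_lt (F : forestD) t : (1 < size F)%N -> t \in F -> (tdeg dg t < nd F)%N.
Proof.
case: F => // t1 [//|t2 F] _; rewrite inE => /orP[/eqP->|].
  rewrite nck_deg_cons -{1}[tdeg dg t1]addn0 ltn_add2l.
  by rewrite (nck_deg_gt0 dg_gt0).
move/mem_tdeg_le/leq_ltn_trans; apply; rewrite [ltnRHS]nck_deg_cons.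
by rewrite -{1}[nd (t2 :: F)]add0n ltn_add2r (tdeg_gt0 dg_gt0).
Qed.

(** An isomorphism up to degree [n]; values above [n] are unconstrained. The inverse [psi] is
    carried along so that bijectivity in low degrees is available as equations. Multiplicativity is
    built into [phi]. *)
Record good n (g : ptree D -> X) (psi : seq J -> {malg K[forestD]}) : Prop := Good {
  good_homog : forall t, (tdeg dg t <= n)%N -> homog wd (tdeg dg t) (g t);
  good_comult : forall t, (tdeg dg t <= n)%N -> comult_at g [:: t];
  good_psiK : forall F, (nd F <= n)%N -> lin psi (phi g F) = << F >>;
  good_psi_homog : forall a, (wd a <= n)%N -> homog nd (wd a) (psi a);
  good_phiK : forall a, (wd a <= n)%N -> lin (phi g) (psi a) = << a >> }.

Lemma good0 : good 0 (fun _ => 0) (fun _ => << [::] >>).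
Proof.
split=> [t|t|F|a|a]; rewrite leqn0.
- by rewrite eqn0Ngt (tdeg_gt0 dg_gt0).
- by rewrite eqn0Ngt (tdeg_gt0 dg_gt0).
- by rewrite (nck_deg_eq0 dg_gt0) => /eqP->; rewrite phi_nil lin_malgU.
- by move/eqP=> ->; apply: (@homogU K _ nd [::]).
- by rewrite (word_deg_eq0 wdeg_gt0) => /eqP->; rewrite lin_malgU phi_nil.
Qed.

(** Only values in degrees at most [n] matter, which allows the final maps to be glued from
    different stages. *)
Lemma eq_good n g psi g' psi' :
  (forall t, (tdeg dg t <= n)%N -> g t = g' t) ->
  (forall a, (wd a <= n)%N -> psi a = psi' a) ->
  good n g psi -> good n g' psi'.
Proof.
move=> gg pp [h1 h2 h3 h4 h5].
have ephi F : (nd F <= n)%N -> phi g F = phi g' F.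
  by move=> Fn; apply: eq_phi => t /mem_tdeg_le tF; apply/gg/leq_trans/Fn.
split=> [t tn|t tn a b|F Fn|a an|a an].
- by rewrite -gg //; apply: h1.
- have tn1 : (nd [:: t] <= n)%N by rewrite nck_deg_cons addn0.
  rewrite -(ephi _ tn1) (h2 t tn a b) big_seq [RHS]big_seq.
  apply: eq_bigr => p /(cuts_deg dg) dp.
  have p1n : (nd p.1 <= n)%N by apply: leq_trans tn1; rewrite -dp leq_addr.
  have p2n : (nd p.2 <= n)%N by apply: leq_trans tn1; rewrite -dp leq_addl.
  by rewrite (ephi _ p1n) (ephi _ p2n).
- rewrite -ephi // -(h3 F Fn); apply: lin_eq_supp => a aF; rewrite pp //.
  suff -> : wd a = nd F by [].
  apply: (homog_phi _ aF) => t /mem_tdeg_le tF; apply: h1.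
  exact: leq_trans tF Fn.
- by rewrite -pp //; apply: h4.
- rewrite -pp // -(h5 a an); apply: lin_eq_supp => F /(h4 a an) FE.
  by rewrite ephi // FE.
Qed.

Variables (I : choiceType) (vdeg : I -> nat) (v : I -> X).
Hypothesis vdeg_gt0 : forall i, (0 < vdeg i)%N.
Hypothesis v_homog : forall i, homog wd (vdeg i) (v i).
Hypothesis v_free : injective (lin (word_val mu << [::] >> v)).

Variables rr tt : nat -> nat.
Hypothesis cW : forall n, card_is (fun w => wd w = n) (rr n).
Hypothesis cJ : forall n, card_is (fun j => wdeg j = n) (tt n).
Hypothesis cV : forall n, card_is (fun w => word_deg vdeg w = n) (rr n).
Hypothesis cI : forall n, card_is (fun i => vdeg i = n) (tt n).
Hypothesis cF : forall n, card_is (fun F => nd F = n) (rr n).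
Hypothesis cT : forall n, card_is (fun t => tdeg dg t = n) (tt n).

Section Step.
Variables (n : nat) (g : ptree D -> X) (psi : seq J -> {malg K[forestD]}).
Hypothesis gd : good n g psi.
Local Notation ph := (phi g).

Lemma small_homog F : (nd F <= n)%N -> homog wd (nd F) (ph F).
Proof.
move=> Fn; apply: homog_phi => t /mem_tdeg_le tF; apply: (good_homog gd).
exact: leq_trans tF Fn.
Qed.

Lemma small_comult F : (nd F <= n)%N -> comult_at g F.
Proof.
move=> Fn; apply: comult_phi => t /mem_tdeg_le tF; apply: (good_comult gd).
exact: leq_trans tF Fn.
Qed.

(* The only possible coefficients of the image of [F] on words with at least two
   letters; by coassociativity every way of cutting [a] in two gives the same value. *)
Definition forced (F : forestD) (a : seq J) :=
  \sum_(p <- cutsF F) (ph p.1)@_(take 1 a) * (ph p.2)@_(drop 1 a).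

Lemma phi_nil_coef a : a != [::] -> (ph [::])@_a = 0.
Proof. by rewrite phi_nil mcoeffU eq_sym => /negPf->. Qed.

Lemma forced_cat F a b : nd F = n.+1 -> a != [::] -> b != [::] ->
  \sum_(p <- cutsF F) (ph p.1)@_a * (ph p.2)@_b = forced F (a ++ b).
Proof.
case: a => // a0 a dF _ bn; rewrite /forced /= take0 drop0.
have small (P R : forestD) : (P, R) \in cutsF F -> P != [::] -> (nd R <= n)%N.
  move=> /(cuts_deg dg) /= PR; rewrite -(nck_deg_gt0 dg_gt0); lia.
have small' (P R : forestD) : (P, R) \in cutsF F -> R != [::] -> (nd P <= n)%N.
  move=> /(cuts_deg dg) /= PR; rewrite -(nck_deg_gt0 dg_gt0); lia.
(* [h] reads the coefficient of the iterated coproduct on [[:: a0]], [a], [b]. Low-degree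
   compatibility merges [[:: a0]] with [a], or [a] with [b]; it applies because a cut with an empty
   side contributes 0 and otherwise both sides have degree at most [n]. *)
pose h P1 P2 R := (ph P1)@_[:: a0] * (ph P2)@_a * (ph R)@_b.
transitivity (\sum_(p <- cutsF F) \sum_(q <- cutsF p.1) h q.1 q.2 p.2).
  rewrite big_seq [RHS]big_seq; apply: eq_bigr => -[P R] PR /=; rewrite -mulr_suml.
  have [->|Rn] := eqVneq R [::]; first by rewrite phi_nil_coef // !mulr0.
  by rewrite -cat1s (small_comult (small' _ _ PR Rn)).
rewrite -(cuts_coassoc F h) big_seq [RHS]big_seq; apply: eq_bigr => -[P R] PR /=.
have [->|Pn] := eqVneq P [::].
  by rewrite phi_nil_coef // mul0r big1 // => q _; rewrite /h phi_nil_coef ?mul0r.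
rewrite (small_comult (small _ _ PR Pn)) mulr_sumr.
by apply: eq_bigr => q _; rewrite mulrA.
Qed.

Lemma mcoeff_nck_delta (F : forestD) p :
  (nck_delta K F)@_p = (count_mem p (cutsF F))%:R.
Proof.
rewrite /nck_delta raddf_sum /= -sum1_count natr_sum [RHS]big_mkcond /=.
by apply: eq_bigr => q _; rewrite mcoeffU; case: eqP.
Qed.

(** Vanishing forced coefficients make [x] primitive: [ph] tensor [ph] sends the coproduct of [x] to
    these coefficients, and it is injective where both degrees are at most [n]. *)
Lemma delta_coef_eq0 (x : {malg K[forestD]}) (P R : forestD) :
  homog nd n.+1 x ->
  (forall a, wd a = n.+1 -> (1 < size a)%N ->
     \sum_(F <- msupp x) x@_F * forced F a = 0) ->
  P != [::] -> R != [::] -> (lin (@nck_delta K D) x)@_(P, R) = 0.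
Proof.
move=> hx fx Pn Rn; set z := lin _ x.
have zdeg p : z@_p != 0 -> (nd p.1 + nd p.2)%N = n.+1.
  rewrite mcoeff_lin; have [/hasP[F Fx]|/hasPn nF] :=
    boolP (has (fun F => p \in cutsF F) (msupp x)).
    by move/(cuts_deg dg)=> ->; rewrite (hx F) // mcoeff_neq0.
  rewrite big_seq big1 ?eqxx // => F /nF pF; rewrite mcoeff_nck_delta.
  by rewrite (count_memPn pF) mulr0.
have [dPR|dPR] := eqVneq (nd P + nd R)%N n.+1; last first.
  by apply/eqP; apply: contraNT dPR => /zdeg /= ->.
(* The component of [z] in the bidegree of [(P, R)]. Both degrees lie between 1 and [n], so [psi]
   tensor [psi] recovers it. *)
pose z0 := homog_part (fun p : forestD * forestD => nd p.1) (nd P) z.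
suff z00 : z0 = 0.
  have := mcoeff_homog_part (fun p : forestD * forestD => nd p.1) (nd P) z (P, R).
  by rewrite -/z0 z00 mcoeff0 eqxx.
have P0 : (0 < nd P)%N by rewrite (nck_deg_gt0 dg_gt0).
have R0 : (0 < nd R)%N by rewrite (nck_deg_gt0 dg_gt0).
have z0deg p : z0@_p != 0 -> nd p.1 = nd P /\ nd p.2 = nd R.
  rewrite mcoeff_homog_part; case: (nd p.1 =P nd P) => [e /zdeg|]; last by rewrite eqxx.
  by rewrite e; lia.
have z0E : lin (tensf psi psi) (lin (tensf ph ph) z0) = z0.
  rewrite linear_lin -[RHS]lin_malgU_id; apply: lin_eq_supp => -[P' R'] /z0deg /= [dP' dR'].
  rewrite /tensf /= lin_tensf !(good_psiK gd) ?tensUU //; lia.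
rewrite -z0E (_ : lin (tensf ph ph) z0 = 0) ?linear0 //.
apply/malgP => -[a b]; rewrite mcoeff0 mcoeff_lin.
have [da|da] := eqVneq (wd a) (nd P); last first.
  rewrite big_seq big1 // => p; rewrite -mcoeff_neq0 => /z0deg[dp1 dp2].
  rewrite mcoeff_tens (homog_coef0 (small_homog _)) ?mul0r ?mulr0 ?dp1 //; lia.
have [db|db] := eqVneq (wd b) (nd R); last first.
  rewrite big_seq big1 // => p; rewrite -mcoeff_neq0 => /z0deg[dp1 dp2].
  have p2n : (nd p.2 <= n)%N by lia.
  by rewrite mcoeff_tens [(ph p.2)@_b](homog_coef0 (small_homog p2n)) ?mulr0 ?dp2.
have an : a != [::] by rewrite -(word_deg_gt0 wdeg_gt0) da.
have bn : b != [::] by rewrite -(word_deg_gt0 wdeg_gt0) db.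
(* Other bidegrees do not contribute. Homogeneity of [ph] fails to be known only in degree [n.+1],
   where the other piece is the empty forest and has coefficient 0 on a nonempty word. *)
transitivity ((lin (tensf ph ph) z)@_(a, b)).
  rewrite -!mcoeff_lin; apply/eqP; rewrite -subr_eq0 -mcoeffB -linearB /=.
  rewrite mcoeff_lin big_seq big1 // => -[P' R'].
  rewrite -mcoeff_neq0 mcoeffB mcoeff_homog_part mcoeff_tens /=.
  case: (nd P' =P nd P) => [_|dP']; first by rewrite subrr eqxx.
  rewrite sub0r oppr_eq0 => /zdeg /= dPR'.
  have [->|Rn'] := eqVneq R' [::]; first by rewrite phi_nil_coef ?mulr0.
  move: Rn'; rewrite -(nck_deg_gt0 dg_gt0) => Rn'.
  rewrite (homog_coef0 (small_homog _)) ?mul0r ?mulr0 //; first by lia.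
  by rewrite da; apply/eqP => e; apply: dP'.
rewrite /z linear_lin mcoeff_lin -[RHS](fx (a ++ b)).
- rewrite big_seq [RHS]big_seq; apply: eq_bigr => F Fx; congr (_ * _).
  rewrite -forced_cat //; last by apply: hx; rewrite mcoeff_neq0.
  rewrite /= /nck_delta linear_sum raddf_sum; apply: eq_bigr => p _.
  by rewrite /= lin_malgU mcoeff_tensE.
- by rewrite word_deg_cat da db.
- by rewrite size_cat; case: (a) an => // ? ?; case: (b) bn => // ? ?; rewrite /= addnS.
Qed.

(** Induction on the degree of the first tree. If its root [d] has children [G], the coproduct
    coefficient at [(G, PNode d [::] :: F)] vanishes, and by [cut_root_first] it involves, besides
    the wanted coefficient, only forests with a smaller first tree. *)
Lemma forced_primitive_eq0 (x : {malg K[forestD]}) :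
  homog nd n.+1 x ->
  (forall a, wd a = n.+1 -> (1 < size a)%N ->
     \sum_(F <- msupp x) x@_F * forced F a = 0) ->
  (forall d F, nd (PNode d [::] :: F) = n.+1 -> x@_(PNode d [::] :: F) = 0) ->
  x = 0.
Proof.
move=> hx fx x0; apply/malgP => F; rewrite mcoeff0.
have [dF|dF] := eqVneq (nd F) n.+1; last exact: homog_coef0 dF.
case: F dF => [//|t F] dF.
have [k kt] := ubnP (tdeg dg t); elim: k => // k IH in t F dF kt *.
case: t dF kt => d [|G0 G] dF kt; first exact: x0.
have := delta_coef_eq0 (P := G0 :: G) (R := PNode d [::] :: F) hx fx isT isT.
rewrite mcoeff_lin; set p := (_, _); set F0 := _ :: F => e.
have [Fx|Fx] := boolP (F0 \in msupp x); last by apply/eqP; rewrite mcoeff_eq0.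
move: e; rewrite (bigD1_seq _ Fx (fset_uniq _)) /= big_seq_cond big1 => [|F'].
  move/eqP; rewrite addr0 mulf_eq0 => /orP[/eqP//|].
  (* The cut may occur several times; characteristic 0 keeps its multiplicity nonzero. *)
  rewrite mcoeff_nck_delta (proj1 (pcharf0P K) charK0) -leqn0 leqNgt -has_count has_pred1.
  by rewrite mem_cut_root.
rewrite mcoeff_nck_delta => /andP[]; rewrite -mcoeff_neq0 => F'x F'0.
have [pF'|pF'] := boolP (p \in cutsF F'); last by rewrite (count_memPn pF') mulr0.
have dF' := hx _ F'x; case: F' F'x F'0 pF' dF' => [//|t' F'] F'x F'0 pF' dF'.
have [e|lt] := cut_root_first dg_gt0 pF'; first by rewrite e eqxx in F'0.
by rewrite IH ?mul0r //; apply: leq_trans lt _.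
Qed.

Lemma long_comult F : nd F = n.+1 -> (1 < size F)%N -> comult_at g F.
Proof.
move=> dF sF; apply: comult_phi => t /(mem_tdeg_lt sF); rewrite dF ltnS.
exact: good_comult gd t.
Qed.

Lemma long_homog F : nd F = n.+1 -> (1 < size F)%N -> homog wd n.+1 (ph F).
Proof.
move=> dF sF; rewrite -dF; apply: homog_phi => t /(mem_tdeg_lt sF).
by rewrite dF ltnS; apply: good_homog gd t.
Qed.

Lemma small_phiK k (x : X) : (k <= n)%N -> homog wd k x ->
  homog nd k (lin psi x) /\ lin ph (lin psi x) = x.
Proof.
move=> kn hx; split.
  by apply: homog_lin hx => a da; rewrite -da; apply: good_psi_homog gd _ _; rewrite da.
rewrite linear_lin -[RHS]lin_malgU_id; apply: lin_eq_supp => a /hx da.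
by apply: good_phiK gd _ _; rewrite da.
Qed.

Lemma nck_mul_supp (x y : {malg K[forestD]}) F :
  (mulH (@nck_mu K D) x y)@_F != 0 ->
  exists F1 F2, [/\ F = F1 ++ F2, x@_F1 != 0 & y@_F2 != 0].
Proof.
rewrite /mulH bilinE mcoeff_lin.
have [/hasP[F1 F1x /hasP[F2 F2y /eqP e]] _|nF] := boolP (has (fun a : forestD =>
    has (fun b : forestD => F == a ++ b) (msupp y)) (msupp x)).
  by exists F1, F2; rewrite !mcoeff_neq0.
rewrite big_seq big1 ?eqxx // => F1 F1x; rewrite mcoeff_lin big_seq big1 ?mulr0 //.
move=> F2 F2y; rewrite mcoeffU; case: eqP => [e|]; rewrite ?mulr0 //.
case/negP: nF; apply/hasP; exists F1 => //; apply/hasP; exists F2 => //.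
by rewrite e.
Qed.

(** The [m] products of at least two free generators are independent. Each splits into two factors
    of degree at most [n], which [psi] lifts; the product of the lifts involves only forests with at
    least two trees. So the [m] rows span a space of rank at least [m]. *)
Lemma decomposables_free m k (sM : seq forestD) (sW : seq (seq J)) :
  (k + m)%N = rr n.+1 -> k = tt n.+1 ->
  uniq sM -> size sM = m ->
  (forall F, (F \in sM) = (nd F == n.+1) && (1 < size F)%N) ->
  uniq sW -> size sW = (k + m)%N -> (forall w, (w \in sW) = (wd w == n.+1)) ->
  row_free (fmat [::] [::] m (k + m) sM sW ph).
Proof.
move=> ekm ek uM zM mM uW zW mW.
have [s1 [sI [_ zI uI _ mI]]] := word_basis (ltn0Sn n) (cI n.+1) (cV n.+1).
have {}zI : size sI = m by rewrite zI -ekm -ek addKn.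
move: uI; rewrite cat_uniq => /and3P[_ _ uI].
set wv := word_val mu << [::] >> v.
have wvh w : homog wd (word_deg vdeg w) (wv w) by apply: homog_word_val.
have fW : row_free (fmat [::] [::] m (k + m) sI sW wv).
  apply: row_free_fmat => // [x _ x0|w]; first by apply: v_free; rewrite x0 linear0.
  by rewrite mI => /andP[/eqP dw _] a /wvh; rewrite mW dw => ->.
have sub : (fmat [::] [::] m (k + m) sI sW wv <= fmat [::] [::] m (k + m) sM sW ph)%MS.
  apply/row_subP => i; set w := nth [::] sI i.
  have : w \in sI by rewrite mem_nth ?zI.
  rewrite mI => /andP[/eqP dw sw].
  have -> : row i (fmat [::] [::] m (k + m) sI sW wv) = coords [::] (k + m) sW (wv w).
    by apply/rowP => j; rewrite !mxE.
  case: w dw sw => [//|i0 w'] dw sw.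
  have dw' : word_deg vdeg (i0 :: w') = (vdeg i0 + word_deg vdeg w')%N by [].
  have w'0 : (0 < word_deg vdeg w')%N by rewrite (word_deg_gt0 vdeg_gt0); case: w' sw {dw dw'}.
  have i00 := vdeg_gt0 i0.
  have [|h1 e1] := small_phiK (k := vdeg i0) _ (@v_homog i0); first by lia.
  have [|h2 e2] := small_phiK (k := word_deg vdeg w') _ (wvh w'); first by lia.
  pose z := mulH (@nck_mu K D) (lin psi (v i0)) (lin psi (wv w')).
  have -> : wv (i0 :: w') = lin ph z by rewrite phi_mulH e1 e2.
  rewrite (coords_lin [::] uM zM); first exact: submxMl.
  move=> F /nck_mul_supp[F1 [F2 [-> /h1 d1 /h2 d2]]].
  rewrite mM nck_deg_cat d1 d2 -dw' dw eqxx /= size_cat.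
  have : (0 < nd F1)%N by rewrite d1.
  have : (0 < nd F2)%N by rewrite d2.
  by rewrite !(nck_deg_gt0 dg_gt0); case: F1 {d1} => // ? ?; case: F2 {d2} => // ? ?; rewrite /= addnS.
have := mxrankS sub; rewrite (eqP fW) => rk.
by rewrite /row_free eqn_leq rank_leq_row.
Qed.

(** Appending to the forced columns the [k] columns [E], which record the coefficients on forests
    starting with a single vertex, makes the rows free by [forced_primitive_eq0]. As [E] has rank at
    most [k], rank [m] remains for the forced columns. *)
Lemma forced_full m k (sF : seq forestD) (sC : seq (seq J)) :
  k = tt n.+1 ->
  uniq sF -> size sF = (k + m)%N -> (forall F, (F \in sF) = (nd F == n.+1)) ->
  size sC = m -> (forall a, (a \in sC) = (wd a == n.+1) && (1 < size a)%N) ->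
  row_full (\matrix_(i < k + m, j < m) forced (nth [::] sF i) (nth [::] sC j)).
Proof.
move=> ek uF zF mF zC mC; set AC := \matrix_(i, j) _.
have [sS [uS zS mS]] := card_corolla_forests (cT n.+1); rewrite -ek in zS.
pose E : 'M[K]_(k + m, k) := \matrix_(i, j) (nth [::] sF i == nth [::] sS j)%:R.
have free : row_free (row_mx AC E).
  apply: inj_row_free => u; rewrite mul_mx_row -[0]row_mx0 => /eq_row_mx[uA uE].
  suff x0 : vec [::] sF u = 0.
    by rewrite -(coords_vec [::] uF zF u) x0; apply/rowP => i; rewrite !mxE mcoeff0.
  apply: forced_primitive_eq0.
  - by move=> F /(vec_supported zF); rewrite mF => /eqP.
  - move=> a da sa; have : a \in sC by rewrite mC da eqxx.
    case/(nth_indexE [::] zC) => j ->.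
    rewrite -[LHS]/(lin (V := K^o) (fun F => forced F (nth [::] sC j)) (vec [::] sF u)).
    rewrite lin_vec; have /rowP/(_ j) := uA; rewrite !mxE => e; rewrite -[RHS]e.
    by apply: eq_bigr => i _; rewrite mxE.
  - move=> d F dF.
    have : PNode d [::] :: F \in sS by apply/mS; split=> //; exists d, F.
    case/(nth_indexE [::] zS) => j ->.
    have /rowP/(_ j) := uE; rewrite !mxE => e; rewrite -[RHS]e /vec raddf_sum.
    by apply: eq_bigr => i _; rewrite mxE /= mcoeffZ mcoeffU.
have : (\rank (row_mx AC E) <= \rank AC + \rank E)%N.
  rewrite -mxrank_tr tr_row_mx -addsmxE -(mxrank_tr AC) -(mxrank_tr E).
  exact: mxrank_adds_leqif.
rewrite (eqP free) => rk; rewrite /row_full eqn_leq rank_leq_col /=.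
by have := rank_leq_col E; lia.
Qed.

Lemma good_step : exists g' psi',
  [/\ forall t, (tdeg dg t <= n)%N -> g t = g' t,
      forall a, (wd a <= n)%N -> psi a = psi' a & good n.+1 g' psi'].
Proof.
pose N := n.+1; pose k := tt N; pose m := (rr N - tt N)%N.
have [lekr _] := card_long_words (ltn0Sn n) (cT N) (cF N).
have ekm : (k + m)%N = rr N by rewrite /k /m subnKC.
have [sT [sM [zT zM uF mT mM]]] := word_basis (ltn0Sn n) (cT N) (cF N).
have [sL [sC [zL zC uW mL mC]]] := word_basis (ltn0Sn n) (cJ N) (cW N).
rewrite -/k -/m in zT zM zL zC.
have mF := mem_word_basis (ltn0Sn n) mT mM; have mW := mem_word_basis (ltn0Sn n) mL mC.
set sF := sT ++ sM in uF mF; set sW := sL ++ sC in uW mW.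
have zF : size sF = (k + m)%N by rewrite size_cat zT zM.
have zW : size sW = (k + m)%N by rewrite size_cat zL zC.
have uM : uniq sM by move: uF; rewrite cat_uniq => /and3P[].
pose A : 'M[K]_(k, m) := \matrix_(i, j) forced (nth [::] sT i) (nth [::] sC j).
pose B := fmat [::] [::] m k sM sL ph; pose C := fmat [::] [::] m m sM sC ph.
have BCE : row_mx B C = fmat [::] [::] m (k + m) sM sW ph by rewrite fmat_cat.
have nthT (i : 'I_k) : nth [::] sF (lshift m i) = nth [::] sT i.
  by rewrite /sF nth_cat zT /= (ltn_ord i).
have nthM (i : 'I_m) : nth [::] sF (rshift k i) = nth [::] sM i.
  by rewrite nth_cat zT /= ltnNge leq_addr addKn.
have inM (i : 'I_m) : nd (nth [::] sM i) = N /\ (1 < size (nth [::] sM i))%N.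
  have : nth [::] sM i \in sM by rewrite mem_nth ?zM.
  by rewrite mM => /andP[/eqP].
(* Decomposable forests only involve trees of degree at most [n], so their actual coefficients on
   longer words already are the forced ones. *)
have ACE : col_mx A C =
    \matrix_(i < k + m, j < m) forced (nth [::] sF i) (nth [::] sC j).
  apply/matrixP => i j; rewrite !mxE; case: (split_ordP i) => l ->.
    by rewrite mxE nthT.
  rewrite mxE nthM; have [dF sF1] := inM l.
  by rewrite -{1}(cat_take_drop 1 (nth [::] sC j)) (long_comult dF sF1).
have fBC : row_free (row_mx B C) by rewrite BCE; apply: decomposables_free.
have fAC : row_full (col_mx A C) by rewrite ACE; apply: forced_full.
have [X0 uX] := block_mx_completion fBC fAC.
set P := block_mx X0 A B C in uX.
(* In degree [N] the index always falls inside the list, so the inner default 0 is never reached;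
   the same holds for [psi']. *)
pose g' t := if tdeg dg t == N then
    if insub (index [:: t] sF) is Some i then vec [::] sW (row i P) else 0
  else g t.
pose psi' a := if wd a == N then
    if insub (index a sW) is Some i then vec [::] sF (row i (invmx P)) else 0
  else psi a.
have eg t : (tdeg dg t <= n)%N -> g t = g' t.
  by move=> tn; rewrite /g' ltn_eqF.
have ep a : (wd a <= n)%N -> psi a = psi' a.
  by move=> an; rewrite /psi' ltn_eqF.
exists g', psi'; split=> //.
have ephi F : (nd F <= n)%N -> phi g F = phi g' F.
  by move=> Fn; apply: eq_phi => t /mem_tdeg_le tF; apply/eg/leq_trans/Fn.
have phi'E (i : 'I_(k + m)) : phi g' (nth [::] sF i) = vec [::] sW (row i P).
  case: (split_ordP i) => l ->.
    have : nth [::] sT l \in sT by rewrite mem_nth ?zT.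
    rewrite mT; case e : (nth [::] sT l) => [|t []]; rewrite ?andbF // andbT.
    rewrite word_deg1 nthT e phi1 /g' => ->.
    have -> : index [:: t] sF = lshift m l.
      by rewrite -e -nthT index_uniq // zF.
    by rewrite valK.
  have [dF sF1] := inM l; rewrite nthM.
  rewrite -(@eq_phi g) => [|t /(mem_tdeg_lt sF1)]; last by rewrite dF ltnS => /eg.
  rewrite /P block_mxEv rowKd BCE -[LHS](coordsK [::] uW zW).
    by congr vec; apply/rowP => j; rewrite !mxE.
  by move=> a /(long_homog dF sF1); rewrite mW => ->.
have psi'E (i : 'I_(k + m)) : psi' (nth [::] sW i) = vec [::] sF (row i (invmx P)).
  have : nth [::] sW i \in sW by rewrite mem_nth ?zW.
  by rewrite mW /psi' => ->; rewrite index_uniq ?zW // valK.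
have hg' t : (tdeg dg t <= N)%N -> homog wd (tdeg dg t) (g' t).
  rewrite leq_eqVlt ltnS => /orP[/eqP dt|tn]; last by rewrite -eg //; apply: good_homog gd _ tn.
  rewrite -phi1; have : [:: t] \in sF by rewrite mF word_deg1 dt.
  case/(nth_indexE [::] zF) => i ->; rewrite phi'E dt => a /(vec_supported zW).
  by rewrite mW => /eqP.
have hphi' F : (nd F <= N)%N -> homog wd (nd F) (phi g' F).
  by move=> Fn; apply: homog_phi => t /mem_tdeg_le tF; apply/hg'/leq_trans/Fn.
split.
- exact: hg'.
- move=> t; rewrite leq_eqVlt ltnS => /orP[/eqP dt|tn] a b; last first.
    have tn1 : (nd [:: t] <= n)%N by rewrite nck_deg_cons addn0.
    rewrite -(ephi _ tn1) (good_comult gd tn) big_seq [RHS]big_seq.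
    apply: eq_bigr => p /(cuts_deg dg) dp.
    have p1n : (nd p.1 <= n)%N by apply: leq_trans tn1; rewrite -dp leq_addr.
    have p2n : (nd p.2 <= n)%N by apply: leq_trans tn1; rewrite -dp leq_addl.
    by rewrite -(ephi _ p1n) -(ephi _ p2n).
  have dF : nd [:: t] = N by rewrite nck_deg_cons addn0.
  have nil0 F : (nd F <= N)%N -> F != [::] -> (phi g' F)@_[::] = 0.
    move=> Fn F0; apply: homog_coef0 (hphi' F Fn) _.
    by rewrite eq_sym (nck_deg_eq0 dg_gt0).
  have le p : p \in cutsF [:: t] -> (nd p.1 <= N)%N /\ (nd p.2 <= N)%N.
    by move/(cuts_deg dg); rewrite dF => <-; rewrite leq_addl leq_addr.
  have nilnil : (phi g' [::])@_[::] = 1 by rewrite phi_nil mcoeffUU.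
  (* With [a] or [b] empty the identity is a counit axiom; otherwise [a ++ b] has at least two
     letters and the block [A] decides. *)
  have [->|an] := eqVneq a [::].
    rewrite cat0s -(sum_cuts_nil1 [:: t] (fun _ F => (phi g' F)@_b)).
    rewrite big_seq [RHS]big_seq; apply: eq_bigr => p /le[p1 p2].
    case: eqP => [->|/eqP p0]; first by rewrite nilnil mul1r.
    by rewrite nil0 ?mul0r.
  have [->|bn] := eqVneq b [::].
    rewrite cats0 -(sum_cuts_nil2 [:: t] (fun F _ => (phi g' F)@_a)).
    rewrite big_seq [RHS]big_seq; apply: eq_bigr => p /le[p1 p2].
    case: eqP => [->|/eqP p0]; first by rewrite nilnil mulr1.
    by rewrite [X in _ * X]nil0 ?mulr0.
  (* Outside degree [N] both sides vanish by homogeneity; the indicator avoids evaluating [forced]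
     there. *)
  transitivity (forced [:: t] (a ++ b) * (wd (a ++ b) == N)%:R).
    have : [:: t] \in sF by rewrite mF word_deg1 dt.
    have [dab|dab _] := eqVneq (wd (a ++ b)) N; last first.
      by rewrite mulr0; apply: homog_coef0 (hphi' _ _) _; rewrite dF.
    have : a ++ b \in sC.
      rewrite mC dab eqxx size_cat.
      by case: (a) an => // ? ?; case: (b) bn => // ? ?; rewrite /= addnS.
    case/(nth_indexE [::] zC) => j jE; have : [:: t] \in sT by rewrite mT word_deg1 dt eqxx.
    case/(nth_indexE [::] zT) => i iE _; rewrite mulr1 iE -nthT phi'E jE.
    have <- : nth [::] sW (rshift k j) = nth [::] sC j.
      by rewrite nth_cat zL /= ltnNge leq_addr addKn.
    by rewrite mcoeff_vec_nth // /P mxE block_mxEur mxE nthT nth_cat zL /= ltnNge leq_addr addKn.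
  have [dab|dab] := eqVneq (wd (a ++ b)) N; last first.
    rewrite mulr0 big_seq big1 // => p pt; have [p1 p2] := le _ pt.
    have [da|da] := eqVneq (wd a) (nd p.1); last by rewrite (homog_coef0 (hphi' _ p1)) ?mul0r.
    have [db|db] := eqVneq (wd b) (nd p.2).
      by move: dab; rewrite word_deg_cat da db (cuts_deg dg pt) dF eqxx.
    by rewrite [X in _ * X](homog_coef0 (hphi' _ p2)) ?mulr0.
  rewrite mulr1 -(forced_cat dF an bn) big_seq [RHS]big_seq; apply: eq_bigr => -[Q R] pt /=.
  have := cuts_deg dg pt; rewrite dF /= => QR.
  have [->|Q0] := eqVneq Q [::]; first by rewrite !phi_nil mcoeffU eq_sym (negPf an) !mul0r.
  have [->|R0] := eqVneq R [::].
    by rewrite !phi_nil (mcoeffU [::] 1 b) [[::] == b]eq_sym (negPf bn) !mulr0.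
  move: Q0 R0; rewrite -!(nck_deg_gt0 dg_gt0) => Q0 R0.
  have Qn : (nd Q <= n)%N by lia.
  have Rn : (nd R <= n)%N by lia.
  by rewrite (ephi _ Qn) (ephi _ Rn).
- move=> F; rewrite leq_eqVlt ltnS => /orP[/eqP dF|Fn].
    have : F \in sF by rewrite mF; apply/eqP.
    case/(nth_indexE [::] zF) => i ->; rewrite phi'E (lin_vec_rows _ psi'E).
    by rewrite -row_mul mulmxV // vec_row1.
  rewrite -ephi // -(good_psiK gd Fn); apply: lin_eq_supp => a /(small_homog Fn) da.
  by rewrite -ep // da.
- move=> a; rewrite leq_eqVlt ltnS => /orP[/eqP da|an].
    have : a \in sW by rewrite mW; apply/eqP.
    case/(nth_indexE [::] zW) => i iE; rewrite iE psi'E -iE da => F /(vec_supported zF).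
    by rewrite mF => /eqP.
  by rewrite -ep //; apply: good_psi_homog gd _ an.
- move=> a; rewrite leq_eqVlt ltnS => /orP[/eqP da|an].
    have : a \in sW by rewrite mW; apply/eqP.
    case/(nth_indexE [::] zW) => i ->; rewrite psi'E (lin_vec_rows _ phi'E).
    by rewrite -row_mul mulVmx // vec_row1.
  rewrite -ep // -(good_phiK gd an); apply: lin_eq_supp => F /(good_psi_homog gd an) dF.
  by rewrite ephi // dF.
Qed.

End Step.

(** Each step preserves the values in lower degrees, so the limit takes the value on a tree or a
    word from the stage equal to its degree. *)
Lemma exists_graded_iso : exists (g : ptree D -> X) (psi : seq J -> {malg K[forestD]}),
  forall n, good n g psi.
Proof.
pose state n := {gp : (ptree D -> X) * (seq J -> {malg K[forestD]}) | good n gp.1 gp.2}.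
have step n (st : state n) : {st' : state n.+1 |
    (forall t, (tdeg dg t <= n)%N -> (sval st).1 t = (sval st').1 t) /\
    (forall a, (wd a <= n)%N -> (sval st).2 a = (sval st').2 a)}.
  apply: constructive_indefinite_description; case: st => -[g psi] /= gd.
  have [g' [psi' [eg ep gd']]] := good_step gd.
  by exists (exist _ (g', psi') gd').
pose st0 : state 0%N := exist _ (_, _) good0.
pose fix st n : state n := if n is n'.+1 then sval (step n' (st n')) else st0.
have stS n : (forall t, (tdeg dg t <= n)%N -> (sval (st n)).1 t = (sval (st n.+1)).1 t) /\
    (forall a, (wd a <= n)%N -> (sval (st n)).2 a = (sval (st n.+1)).2 a).
  exact: (svalP (step n (st n))).
have stg n t : (tdeg dg t <= n)%N -> (sval (st n)).1 t = (sval (st (tdeg dg t))).1 t.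
  elim: n => [|n IH]; first by rewrite leqn0 => /eqP->.
  rewrite leq_eqVlt => /orP[/eqP->//|]; rewrite ltnS => tn.
  by rewrite -(proj1 (stS n)) // IH.
have stp n a : (wd a <= n)%N -> (sval (st n)).2 a = (sval (st (wd a))).2 a.
  elim: n => [|n IH]; first by rewrite leqn0 => /eqP->.
  rewrite leq_eqVlt => /orP[/eqP->//|]; rewrite ltnS => tn.
  by rewrite -(proj2 (stS n)) // IH.
exists (fun t => (sval (st (tdeg dg t))).1 t), (fun a => (sval (st (wd a))).2 a) => n.
by apply: eq_good (svalP (st n)) => [t|a]; [exact: stg | exact: stp].
Qed.
Lemma exists_nck_iso : exists ph : forestD -> X,
  [/\ graded_map nd wd ph, bijective (lin ph), ph [::] = << [::] >>,
      forall x y, lin ph (mulH (@nck_mu K D) x y) = M (lin ph x) (lin ph y)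
    & forall F a b, (ph F)@_(a ++ b) =
        \sum_(p <- cutsF F) (ph p.1)@_a * (ph p.2)@_b].
Proof.
have [g [psi gd]] := exists_graded_iso; exists (phi g); split.
- apply/graded_mapP => F; apply: homog_phi => t _.
  exact: good_homog (gd _) _ (leqnn _).
- exists (lin psi) => x; rewrite linear_lin -[RHS]lin_malgU_id.
    by apply: eq_lin => F; exact: good_psiK (gd _) _ (leqnn _).
  by apply: eq_lin => a; exact: good_phiK (gd _) _ (leqnn _).
- by [].
- exact: phi_mulH.
- by move=> F; apply: comult_phi => t _; exact: good_comult (gd _) _ (leqnn _).
Qed.

End Extension.

(** * Transport to the deconcatenation coalgebra *)

Section Deconcatenation.
Variables (K : fieldType) (J : choiceType).

Lemma mcoeff_deconc (w a b : seq J) : (deconc K w)@_(a, b) = (w == a ++ b)%:R.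
Proof.
rewrite /deconc raddf_sum /=.
transitivity (\sum_(i < (size w).+1) ((w == a ++ b) && (val i == size a))%:R : K).
  apply: eq_bigr => i _; rewrite mcoeffU; congr (nat_of_bool _)%:R.
  have iw : (i <= size w)%N by rewrite -ltnS.
  apply/eqP/andP => [[<- <-]|[/eqP we /eqP ie]].
    by rewrite cat_take_drop size_take_min (minn_idPl iw) !eqxx.
  by rewrite ie we take_size_cat ?drop_size_cat.
have [->|_] := eqVneq w (a ++ b); last by rewrite big1.
have lt : (size a < (size (a ++ b)).+1)%N by rewrite ltnS size_cat leq_addr.
rewrite (bigD1 (Ordinal lt)) //= eqxx big1 ?addr0 // => i.
by rewrite -val_eqE /= => /negPf->.
Qed.

Lemma mcoeff_lin_deconc (x : {malg K[seq J]}) a b :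
  (lin (@deconc K J) x)@_(a, b) = x@_(a ++ b).
Proof.
rewrite mcoeff_lin (mcoeff_expand x (a ++ b)); apply: eq_bigr => w _.
by rewrite mcoeff_deconc.
Qed.

Lemma has_coprodP (x : {malg K[seq J]}) s :
  has_coprod x s <-> lin (@deconc K J) x = \sum_(p <- s) tens p.1 p.2.
Proof.
split=> [h|h a b].
  apply/malgP => -[a b]; rewrite mcoeff_lin_deconc h raddf_sum.
  by apply: eq_bigr => p _; rewrite /= mcoeff_tens.
rewrite -mcoeff_lin_deconc h raddf_sum; apply: eq_bigr => p _.
by rewrite /= mcoeff_tens.
Qed.

Lemma linK_eps_word (x : {malg K[seq J]}) : linK (@eps_word K J) x = x@_[::].
Proof. by rewrite (mcoeff_expand x). Qed.

End Deconcatenation.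

(** * Hopf axioms extended from basis vectors to all elements *)

Section HopfExtension.
Variables (K : fieldType) (B : choiceType).
Variables (mu : B -> B -> {malg K[B]}) (u : {malg K[B]}).
Variables (delta : B -> {malg K[(B * B)%type]}) (eps : B -> K).

Lemma mulHA : (forall a b c, mulH mu (mu a b) << c >> = mulH mu << a >> (mu b c)) ->
  forall x y z, mulH mu (mulH mu x y) z = mulH mu x (mulH mu y z).
Proof.
move=> hA x y z; rewrite /mulH.
apply: (@linear_malg_ext K _ _ (bilin mu (bilin mu x y)) (bilin mu x \o bilin mu y)).
move=> c /=; rewrite !bilinUr.
apply: (@linear_malg_ext K _ _ (lin (mu^~ c) \o bilin mu x) (bilin mu x \o lin (mu^~ c))).
move=> b /=; rewrite bilinUr lin_malgU [RHS]bilinE linear_lin; apply: eq_lin => a /=.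
by rewrite -bilinUr -bilinUl; apply: hA.
Qed.

Lemma mul1H : (forall b, mulH mu u << b >> = << b >>) -> forall x, mulH mu u x = x.
Proof.
move=> h1 x; rewrite -[RHS]lin_malgU_id /mulH bilinEr; apply: eq_lin => b.
by rewrite -bilinUr; apply: h1.
Qed.

Lemma mulH1 : (forall b, mulH mu << b >> u = << b >>) -> forall x, mulH mu x u = x.
Proof.
move=> h1 x; rewrite -[RHS]lin_malgU_id /mulH bilinE; apply: eq_lin => b.
by rewrite -bilinUl; apply: h1.
Qed.

Definition tens_mul (p q : B * B) := tens (mu p.1 q.1) (mu p.2 q.2).

Lemma bilin_tens_mul a b c d :
  bilin tens_mul (tens a b) (tens c d) = tens (mulH mu a c) (mulH mu b d).
Proof.
rewrite bilinE lin_tens_bilin /mulH (bilinE mu a) (bilinE mu b) /tens bilin_lin.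
apply: eq_bilin => i j; rewrite lin_tens_bilin bilin_lin.
by apply: eq_bilin.
Qed.

Lemma delta_mulH :
  (forall a b, lin delta (mu a b) = bilin tens_mul (delta a) (delta b)) ->
  forall x y, lin delta (mulH mu x y) = bilin tens_mul (lin delta x) (lin delta y).
Proof.
by move=> h x y; rewrite bilin_lin /mulH linear_bilin; apply: eq_bilin => a b; apply: h.
Qed.

End HopfExtension.

Section Transport.
Variables (K : fieldType) (B : choiceType) (deg : B -> nat).
Variables (mu : B -> B -> {malg K[B]}) (u : {malg K[B]}).
Variables (delta : B -> {malg K[(B * B)%type]}) (eps : B -> K).
Hypothesis hopf : is_gc_hopf deg mu u delta eps.
Variables (J : choiceType) (wdeg : J -> nat).
Hypothesis wdeg_gt0 : forall j, (0 < wdeg j)%N.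
Local Notation wd := (word_deg wdeg).
Variables (f : B -> {malg K[seq J]}) (fi : seq J -> {malg K[B]}).
Hypothesis f_iso : coalg_iso deg wd delta eps (@deconc K J) (@eps_word K J) f.
Hypothesis fK : cancel (lin f) (lin fi).
Hypothesis fiK : cancel (lin fi) (lin f).

Definition word_mu (w w' : seq J) := lin f (mulH mu (fi w) (fi w')).

Lemma word_mulE x y :
  mulH word_mu x y = lin f (mulH mu (lin fi x) (lin fi y)).
Proof. by rewrite /mulH bilin_lin linear_bilin. Qed.

Lemma lin_mulH x y :
  lin f (mulH mu x y) = mulH word_mu (lin f x) (lin f y).
Proof. by rewrite word_mulE !fK. Qed.

(** A coalgebra isomorphism is not assumed to preserve the unit. Its degree forces the image of [u]
    to be a multiple of the empty word, and the counit fixes the scalar to 1. *)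
Lemma lin_unit : lin f u = << [::] >>.
Proof.
have [_ [_ [[_ hu _ _] [_ [_ [[_ _ _ epsu] _]]]]]] := hopf.
have [gf _ _ fe] := f_iso.
have hfu : homog wd 0 (lin f u).
  apply: (homog_lin (dA := deg)); last exact/homogP.
  by move=> b <-; apply/graded_mapP: b.
have e1 : (lin f u)@_[::] = 1.
  rewrite -linK_eps_word linKE linear_lin -[RHS]epsu [RHS]linKE.
  by apply: (@eq_lin K B K^o) => b; rewrite -fe.
apply/malgP => w; rewrite mcoeffU; have [<-|wn] := eqVneq [::] w; first exact: e1.
by apply: homog_coef0 hfu _; rewrite (word_deg_eq0 wdeg_gt0) eq_sym.
Qed.

Lemma word_mulA x y z :
  mulH word_mu (mulH word_mu x y) z = mulH word_mu x (mulH word_mu y z).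
Proof.
have [_ [_ [_ [[hA _] _]]]] := hopf.
have surj t : exists t0, t = lin f t0 by exists (lin fi t).
have [x0 ->] := surj x; have [y0 ->] := surj y; have [z0 ->] := surj z.
by rewrite -(lin_mulH x0) -(lin_mulH y0) -!lin_mulH (mulHA hA).
Qed.

Lemma word_mul1 x : mulH word_mu << [::] >> x = x.
Proof.
have [_ [_ [_ [[_ h1] _]]]] := hopf.
rewrite -lin_unit word_mulE fK mul1H ?fiK // => b; exact: (proj1 (h1 b)).
Qed.

Lemma word_mulr1 x : mulH word_mu x << [::] >> = x.
Proof.
have [_ [_ [_ [[_ h1] _]]]] := hopf.
rewrite -lin_unit word_mulE fK mulH1 ?fiK // => b; exact: (proj2 (h1 b)).
Qed.

Lemma homog_word_mu a b : homog wd (wd a + wd b)%N (word_mu a b).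
Proof.
have [_ [_ [[hm _ _ _] _]]] := hopf.
have [gf _ _ _] := f_iso; have gfi := graded_inverse gf fK fiK.
apply: (homog_lin (dA := deg)) => [c <-|]; first by apply/graded_mapP: c.
apply: homog_bilin => [c d||].
- by apply/homogP => e; apply: hm.
- by apply/graded_mapP: a.
- by apply/graded_mapP: b.
Qed.

Lemma lin_deconc_lin x :
  lin (@deconc K J) (lin f x) = lin (tensf f f) (lin delta x).
Proof.
have [_ _ fd _] := f_iso.
by rewrite !linear_lin; apply: eq_lin => b; apply: fd.
Qed.

Lemma delta_of_coprod x s : has_coprod x s ->
  lin delta (lin fi x) = \sum_(p <- s) tens (lin fi p.1) (lin fi p.2).
Proof.
move=> /has_coprodP hx; rewrite -[LHS](lin_tensfK fK) -lin_deconc_lin fiK hx.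
by rewrite linear_sum; apply: eq_bigr => p _; rewrite /= lin_tensf.
Qed.

Lemma has_coprod_mul x y s s' : has_coprod x s -> has_coprod y s' ->
  has_coprod (mulH word_mu x y)
    [seq (mulH word_mu p.1 q.1, mulH word_mu p.2 q.2) | p <- s, q <- s'].
Proof.
move=> /delta_of_coprod hx /delta_of_coprod hy; apply/has_coprodP.
have [_ [_ [_ [_ [_ [[hd _ _ _] _]]]]]] := hopf.
rewrite big_allpairs_dep word_mulE lin_deconc_lin (delta_mulH hd) hx hy bilin_sum.
rewrite linear_sum; apply: eq_bigr => p _; rewrite linear_sum; apply: eq_bigr => q _.
by rewrite /= bilin_tens_mul lin_tensf !word_mulE.
Qed.

Lemma lin_word_val (I : choiceType) (v : I -> {malg K[B]}) w :
  lin f (word_val mu u v w) = word_val word_mu << [::] >> (fun i => lin f (v i)) w.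
Proof.
elim: w => [|i w IH]; first exact: lin_unit.
by rewrite [word_val _ _ _ _]/= [RHS]/= -IH -lin_mulH.
Qed.

End Transport.

(** * Graded sets, homogeneous generators and assembly *)

Lemma eq_Dpoly_int (r r' : nat -> int) n :
  (forall k, (0 < k)%N -> r k = r' k) -> Dpoly_int r n = Dpoly_int r' n.
Proof.
move=> rr'; rewrite /Dpoly_int.
suff -> : \sum_(1 <= j < n.+1) r j *: 'X^j = \sum_(1 <= j < n.+1) r' j *: 'X^j :> {poly int} by [].
by apply: eq_big_nat => j /andP[j0 _]; rewrite rr'.
Qed.

Lemma graded_set_card (D : choiceType) (dg : D -> nat) :
  graded_set dg -> exists a, forall n, card_is (fun d => dg d = n) (a n).
Proof.
case=> _ fin; apply: choose_cards => n; have [s hs] := fin n.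
set s' := undup [seq d <- s | dg d == n].
exists (size s'), s'; split=> //; first exact: undup_uniq.
move=> d; rewrite mem_undup mem_filter; split=> [dn|/andP[/eqP]//].
by rewrite dn eqxx hs.
Qed.

Section SigmaGraded.
Variable a : nat -> nat.

(** A graded set with [a n] elements in each degree [n > 0]; the shift excludes degree 0. *)
Definition sigma_deg (x : {k : nat & 'I_(a k.+1)}) := (tag x).+1.

Lemma card_sigma_deg n :
  card_is (fun x => sigma_deg x = n) (if n is 0 then 0 else a n)%N.
Proof.
case: n => [|n]; first exact: card_is0.
have injT : injective (fun i : 'I_(a n.+1) => Tagged (fun k => 'I_(a k.+1)) i).
  by move=> i j /eqP; rewrite eq_Tagged => /eqP.
have cI : card_is (fun _ : 'I_(a n.+1) => True) (a n.+1).
  exists (enum 'I_(a n.+1)); split; first exact: enum_uniq.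
    by rewrite size_enum_ord.
  by move=> i; rewrite mem_enum.
apply: card_is_ext (card_is_image injT cI) => -[k i]; rewrite /sigma_deg /=.
split=> [[j _ /(congr1 (@tag _ _)) /= ->//]|[kn]].
by subst k; exists i.
Qed.

Lemma graded_set_sigma : graded_set sigma_deg.
Proof.
split=> // n; have [s [_ _ hs]] := card_sigma_deg n.
by exists s => x /hs.
Qed.

End SigmaGraded.

Section FreeGenerators.
Variables (K : fieldType) (B : choiceType) (deg : B -> nat).
Variables (mu : B -> B -> {malg K[B]}) (u : {malg K[B]}).
Variables (delta : B -> {malg K[(B * B)%type]}) (eps : B -> K).
Hypothesis hopf : is_gc_hopf deg mu u delta eps.

(** Connectedness leaves one basis vector in degree 0, and the counit shows that [u] is a nonzero
    multiple of it. *)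
Lemma homog0_unit (x : {malg K[B]}) : homog deg 0 x -> exists c, x = c *: u.
Proof.
have [_ [[b0 hb0] [[_ hu _ _] [_ [_ [[_ _ _ epsu] _]]]]]] := hopf.
have supp (y : {malg K[B]}) : homog deg 0 y -> y = y@_b0 *: << b0 >>.
  move=> hy; apply/malgP => b; rewrite mcoeffZ mcoeffU.
  have [<-|nb] := eqVneq b0 b; first by rewrite mulr1.
  rewrite mulr0; apply: homog_coef0 hy _.
  by apply: contraNneq nb => /hb0->.
have hu0 : homog deg 0 u by apply/homogP.
have ub0 : u@_b0 != 0.
  apply/eqP => u0; have := epsu; rewrite (supp u hu0).
  by rewrite u0 scale0r linKE linear0 => /esym/eqP; rewrite oner_eq0.
move=> /supp xE; exists (x@_b0 / u@_b0); rewrite {1}xE.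
transitivity ((x@_b0 / u@_b0) *: (u@_b0 *: << b0 >> : {malg K[B]})).
  by rewrite scalerA mulfVK.
by rewrite -(supp u hu0).
Qed.

Lemma free_generators_graded : is_free_alg deg mu u ->
  exists (I : choiceType) (vdeg : I -> nat) (v : I -> {malg K[B]}),
    [/\ forall i, (0 < vdeg i)%N, forall i, homog deg (vdeg i) (v i)
      & bijective (lin (word_val mu u v))].
Proof.
have [_ [_ [_ [[_ h1] _]]]] := hopf.
move=> [I [v [vh bij]]]; have inj := bij_inj bij.
(* A zero generator gets degree 0; the argument below, that a generator of degree 0 is a multiple of
   the unit and contradicts freeness, excludes it as well. *)
pose vdeg i := if msupp (v i) : seq B is b :: _ then deg b else 0%N.
have v1 i : word_val mu u v [:: i] = v i by apply: mulH1 => b; apply: (proj2 (h1 b)).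
have hom i : homog deg (vdeg i) (v i).
  have [n hn] := vh i; apply/homogP => c ci; rewrite (hn c) // /vdeg.
  have : c \in enum_fset (msupp (v i)) by [].
  case E : (enum_fset _) => [//|b s] _; apply/esym/hn.
  by have : b \in enum_fset (msupp (v i)) by rewrite E mem_head.
exists I, vdeg, v; split=> // i; rewrite lt0n; apply/eqP => di.
have := hom i; rewrite di => /homog0_unit[c vi].
have : << [:: i] >> = c *: << [::] >> :> {malg K[seq I]}.
  by apply: inj; rewrite linearZ /= !lin_malgU v1.
move/(congr1 (fun x => x@_[:: i])); rewrite mcoeffUU mcoeffZ mcoeffU mulr0.
by move/eqP; rewrite oner_eq0.
Qed.

Lemma homog_word_val_gens (I : choiceType) (vdeg : I -> nat) (v : I -> {malg K[B]}) :
  (forall i, homog deg (vdeg i) (v i)) ->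
  graded_map (word_deg vdeg) deg (word_val mu u v).
Proof.
have [_ [_ [[hm hu _ _] _]]] := hopf.
move=> hv; apply/graded_mapP; elim=> [|i w IH]; first exact/homogP.
apply: homog_bilin (hv i) IH => a b; apply/homogP => c; exact: hm.
Qed.

End FreeGenerators.

Section Composition.
Variables (K : fieldType) (B J D : choiceType) (deg : B -> nat) (wdeg : J -> nat).
Variable dg : D -> nat.
Variables (mu : B -> B -> {malg K[B]}) (u : {malg K[B]}).
Variables (delta : B -> {malg K[(B * B)%type]}) (eps : B -> K).
Local Notation wd := (word_deg wdeg).
Local Notation nd := (nck_deg dg).
Variables (f : B -> {malg K[seq J]}) (ph : forest D -> {malg K[seq J]}).
Variable wmu : seq J -> seq J -> {malg K[seq J]}.
Hypothesis f_iso : coalg_iso deg wd delta eps (@deconc K J) (@eps_word K J) f.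
Hypothesis f_mul : forall x y, lin f (mulH mu x y) = mulH wmu (lin f x) (lin f y).
Hypothesis f_unit : lin f u = << [::] >>.
Hypothesis ph_graded : graded_map nd wd ph.
Hypothesis ph_bij : bijective (lin ph).
Hypothesis ph_nil : ph [::] = << [::] >>.
Hypothesis ph_mul : forall x y,
  lin ph (mulH (@nck_mu K D) x y) = mulH wmu (lin ph x) (lin ph y).
Hypothesis ph_comult : forall F a b, (ph F)@_(a ++ b) =
  \sum_(p <- cutsF F) (ph p.1)@_a * (ph p.2)@_b.
Hypothesis dg_gt0 : forall d, (0 < dg d)%N.

(** The isomorphism is [f] followed by the inverse of [ph]; the product and coproduct identities are
    checked after applying [ph] or its tensor square, which are injective. *)
Lemma nck_iso_compose : exists h : B -> {malg K[forest D]},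
  hopf_iso deg nd mu u delta eps (@nck_mu K D) (nck_unit K D) (@nck_delta K D)
    (@nck_eps K D) h.
Proof.
have [gf bf fd fe] := f_iso.
have [psi [phK psiK]] := lin_bijective_inverse ph_bij.
have gpsi := graded_inverse ph_graded phK psiK.
pose h b := lin psi (f b).
have hE x : lin h x = lin psi (lin f x) by rewrite linear_lin.
have phh b : lin ph (h b) = f b by rewrite psiK.
have delta_ph x : lin (tensf ph ph) (lin (@nck_delta K D) x) = lin (@deconc K J) (lin ph x).
  rewrite !linear_lin; apply: eq_lin => F /=; apply/malgP => -[a b].
  rewrite mcoeff_lin_deconc ph_comult /nck_delta linear_sum raddf_sum.
  by apply: eq_bigr => p _; rewrite /= lin_malgU mcoeff_tens.
exists h; split; [split|..].
- apply/graded_mapP => b; apply: (homog_lin (dA := wd)) => [a <-|].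
    by apply/graded_mapP: a.
  by apply/graded_mapP: b.
- apply: (@eq_bij _ _ (lin psi \o lin f)) => [|x]; last by rewrite hE.
  by apply: bij_comp => //; exists (lin ph).
- move=> b; apply: (can_inj (lin_tensfK phK)); rewrite delta_ph phh fd.
  rewrite linear_lin; apply: eq_lin => p /=.
  by rewrite lin_tensf !phh.
- move=> b; rewrite -fe.
  rewrite linK_eps_word -[in RHS]phh mcoeff_lin; apply: eq_bigr => F _; congr (_ * _).
  have [->|Fn] := eqVneq F [::]; first by rewrite ph_nil mcoeffUU /nck_eps eqxx.
  rewrite /nck_eps (negPf Fn); symmetry; apply: (homog_coef0 (n := nd F) (deg := wd)).
    exact: (proj1 (graded_mapP _ _ _) ph_graded F).
  by rewrite eq_sym (nck_deg_eq0 dg_gt0).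
- move=> a b; rewrite hE -(bilinUU mu) -/(mulH mu _ _) f_mul !lin_malgU.
  by apply: (can_inj phK); rewrite psiK ph_mul !phh.
- by rewrite hE f_unit -ph_nil -(lin_malgU ph) phK.
Qed.

End Composition.

Theorem theorem21 (K : fieldType) (charK0 : [pchar K] =i pred0)
    (B : choiceType) (deg : B -> nat)
    (mu : B -> B -> {malg K[B]}) (u : {malg K[B]})
    (delta : B -> {malg K[(B * B)%type]}) (eps : B -> K)
    (r : nat -> nat) :
  is_gc_hopf deg mu u delta eps ->
  is_free_alg deg mu u ->
  is_cofree_coalg deg delta eps ->
  (forall n : nat, (0 < n)%N -> dim_deg deg n (r n)) ->
  (exists (D : choiceType) (dg : D -> nat),
      graded_set dg /\
      exists f : B -> {malg K[forest D]},
        hopf_iso deg (nck_deg dg) mu u delta eps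
          (@nck_mu K D) (nck_unit K D) (@nck_delta K D) (@nck_eps K D) f)
  <->
  (forall n : nat, (0 < n)%N -> 0 <= Dpoly_int (fun j => (r j)%:Z) n).
Proof.
move=> hopf free [J [wdeg [wdeg_gt0 [f f_iso]]]] dims; split.
  (* Necessity: an isomorphism equates the dimensions, and [D_n] is then the number of decorations
     of degree [n]. *)
  move=> [D [dg [gD [h [[gh bh _ _] _ _]]]]] n n0.
  have [a ca] := graded_set_card gD; have dg_gt0 := proj1 gD.
  have [b [t [cb _ b0 bS tS]]] := card_forests_exist dg_gt0 ca.
  rewrite (eq_Dpoly_int (r' := fun j => (b j)%:Z)) => [|k k0].
    by rewrite (Dpoly_int_unique bS tS b0 n0).
  by congr Posz; apply: card_is_inj (cb k); apply: dim_deg_iso gh bh (dims k k0).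
move=> D_ge0; pose d n := absz (Dpoly_int (fun j => (r j)%:Z) n).
exists {k : nat & 'I_(d k.+1)}, (@sigma_deg d); split; first exact: graded_set_sigma.
set dg := @sigma_deg d; have dg_gt0 x : (0 < dg x)%N by [].
have [b [t [cb ct b0 bS tS]]] := card_forests_exist dg_gt0 (card_sigma_deg d).
(* The forests and [H] have the same [D_n], and these determine the dimensions. *)
have br n : (0 < n)%N -> b n = r n.
  move=> n0; have [] // : (b n)%:Z = (r n)%:Z.
  apply: (Dpoly_int_inj (f := fun j => (b j)%:Z) (r := fun j => (r j)%:Z)) n0 => k k0.
  rewrite (Dpoly_int_unique bS tS b0 k0); case: k k0 => // k k0.
  by rewrite /d gez0_abs ?D_ge0.
have t0 : t 0%N = 0%N by apply: card_is_inj (ct 0%N) (card_letters0 (tdeg_gt0 dg_gt0)).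
have [gf bf _ _] := f_iso; have [fi [fK fiK]] := lin_bijective_inverse bf.
have [I [vdeg [v [vdeg_gt0 vh vbij]]]] := free_generators_graded hopf free.
(* [dims] says nothing about degree 0, where the empty word is the only word. *)
have cW n : card_is (fun w => word_deg wdeg w = n) (b n).
  case: n => [|n]; first by rewrite b0; apply: card_words0.
  by rewrite br //; apply: dim_deg_iso gf bf (dims _ _).
have cV n : card_is (fun w => word_deg vdeg w = n) (b n).
  case: n => [|n]; first by rewrite b0; apply: card_words0.
  rewrite br //; apply: dim_deg_iso_inv (homog_word_val_gens hopf vh) vbij (dims _ _) => //.
(* Letters, free generators and trees now share the count [t], which makes the block of trees
   against letters square in every degree. *)
have cJ := card_letters_determined wdeg_gt0 cW bS t0.
have cI := card_letters_determined vdeg_gt0 cV bS t0.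
have v'h i : homog (word_deg wdeg) (vdeg i) (lin f (v i)).
  by apply: homog_lin (vh i) => c <-; apply/graded_mapP: c.
have v'free : injective (lin (word_val (word_mu mu f fi) << [::] >> (fun i => lin f (v i)))).
  move=> x y; rewrite -!(eq_lin (lin_word_val hopf wdeg_gt0 f_iso fK v)) -!linear_lin.
  by move/(can_inj fK)/(bij_inj vbij).
have [ph [gph bph ph0 phM phD]] := exists_nck_iso charK0 wdeg_gt0
  (word_mulA hopf fK fiK) (word_mul1 hopf wdeg_gt0 f_iso fK fiK)
  (word_mulr1 hopf wdeg_gt0 f_iso fK fiK) (homog_word_mu hopf f_iso fK fiK)
  (has_coprod_mul hopf f_iso fK fiK) dg_gt0 vdeg_gt0 v'h v'free cW cJ cV cI cb ct.
exact: (nck_iso_compose f_iso (lin_mulH mu fK) (lin_unit hopf wdeg_gt0 f_iso)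
  gph bph ph0 phM phD dg_gt0).
Qed.
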